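(* Let $S\subset\mathbb{R}^d$ be a finite spanning set that is weakly non-degenerate. Then for every $\mathcal P\in\mathcal P(S)$ the standard measure $\mu_{\mathcal P}$ belongs to $\mathfrak M^\Delta(S)$. In other words, $\mathfrak M(S)=\mathfrak M^\Delta(S)$.
   Context: A finite set in $\mathbb{R}^d$ is spanning if it is not contained in any affine hyperplane. A finite spanning set $S$ is weakly non-degenerate if every $(d+2)$-tuple of (distinct) points of $S$ is spanning. A generalized polytope in $\mathbb{R}^d$ is a subset that is a finite union of $d$-dimensional compact convex polytopes. A dissection of a generalized polytope $\mathcal P$ is a finite collection of pairwise disjoint open $d$-dimensional simplices such that the closure of their union equals $\mathcal P$. A point $\mathbf v$ is a vertex of $\mathcal P$ if, for every dissection of $\mathcal P$, $\mathbf v$ is a vertex of (the closure of) some simplex of the dissection. $\mathcal P(S)$ denotes the set of all generalized polytopes whose vertex sets are contained in $S$. The standard measure $\mu_{\mathcal P}$ is $\chi_{\mathcal P}\,dx_1\cdots dx_d$ (Lebesgue measure restricted to $\mathcal P$). $\mathfrak M(S)$ is the real linear span of all $\mu_{\mathcal P}$, $\mathcal P\in\mathcal P(S)$, and $\mathfrak M^\Delta(S)\subseteq\mathfrak M(S)$ is the subspace spanned by $\mu_\Delta$ for all $d$-dimensional simplices $\Delta$ with vertices in $S$. *)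

(* Defs.v *)
From HB Require Import structures.
From mathcomp Require Import all_boot all_order all_algebra.
From mathcomp Require Import all_classical all_reals all_analysis.
From mathcomp Require Import measurable_realfun.
Set Implicit Arguments.
Unset Strict Implicit.
Unset Printing Implicit Defensive.
Import Order.TTheory GRing.Theory Num.Theory.
Import numFieldNormedType.Exports.
Local Open Scope classical_set_scope.
Local Open Scope ring_scope.

(* R^d is 'rV[R]_d with the sigma-algebra generated by its open sets. *)
Notation borel_rV R d := (g_sigma_algebraType (@open 'rV[R]_d)).

Lemma ball_rV (R : realType) (d : nat) (x y : 'rV[R]_d) (e : R) :
  0 < e -> ball x e y <-> forall i, `|x ord0 i - y ord0 i| < e.
Proof.
move=> e0; split.
  by move=> [_ h] i; have := h ord0 i; rewrite -ball_normE.
move=> h; split=> // i j; rewrite -ball_normE /= (ord1 i); exact: h.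
Qed.

Definition cons_rV (R : realType) (d : nat) (x : R * borel_rV R d) :
    borel_rV R d.+1 :=
  row_mx (x.1%:M : 'M[R]_1) (x.2 : 'rV[R]_d).

Definition uncons_rV (R : realType) (d : nat) (x : borel_rV R d.+1) :
    R * borel_rV R d :=
  ((x : 'rV[R]_d.+1) ord0 ord0, rsubmx (x : 'rV[R]_(1 + d))).

Lemma cons_rVK (R : realType) (d : nat) : cancel (@cons_rV R d) (@uncons_rV R d).
Proof.
move=> [x v]; rewrite /uncons_rV /cons_rV row_mxKr; congr (_, _).
rewrite [LHS]mxE; case: splitP => // j _.
by rewrite (ord1 j) mxE eqxx mulr1n.
Qed.

Lemma uncons_rVK (R : realType) (d : nat) : cancel (@uncons_rV R d) (@cons_rV R d).
Proof.
move=> x; rewrite /uncons_rV /cons_rV /=.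
have -> : ((x : 'rV[R]_d.+1) ord0 ord0)%:M =
    lsubmx (x : 'rV[R]_(1 + d)) :> 'M[R]_1.
  rewrite [RHS]mx11_scalar mxE.
  by congr (fun_of_matrix _ _ _)%:M; exact/val_inj.
exact: (@hsubmxK R 1 1 d).
Qed.

Lemma cons_rV_measurable (R : realType) (d : nat) :
  measurable_fun [set: R * borel_rV R d] (@cons_rV R d).
Proof.
apply: (@measurability _ _ _ (borel_rV R d.+1) _ _ (@open 'rV[R]_d.+1)) => // _ [U oU <-].
rewrite setTI.
pose C (k : rat * 'rV[rat]_d * nat) : set (R * borel_rV R d) :=
  ball (ratr k.1.1 : R) k.2.+1%:R^-1
    `*` (ball (map_mx ratr k.1.2 : 'rV[R]_d) k.2.+1%:R^-1 : set 'rV[R]_d).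
pose G k := if `[< C k `<=` @cons_rV R d @^-1` U >] then C k else set0.
have -> : @cons_rV R d @^-1` U = \bigcup_k G k.
  apply/seteqP; split=> [[x v]/= Uxv|x [k _]]; last first.
    by rewrite /G; case: asboolP => // h /h.
  have [e/= e0 eU] : exists2 e : R, 0 < e &
      ball (row_mx (x%:M : 'M[R]_1) (v : 'rV[R]_d)) e `<=` U.
    have /nbhs_ballP[e e0 eU] : nbhs (row_mx (x%:M : 'M[R]_1) (v : 'rV[R]_d)) U.
      exact: open_nbhs_nbhs.
    by exists e.
  pose n := Num.truncn (2 / e).
  have n2 : n.+1%:R^-1 * 2 < e.
    rewrite mulrC ltr_pdivrMr// mulrC -ltr_pdivrMr//; exact: truncnS_gt.
  have ngt0 : (0 : R) < n.+1%:R^-1 by rewrite invr_gt0.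
  have rapp (y : R) : exists q : rat, `|ratr q - y| < n.+1%:R^-1.
    have /rat_in_itvoo[q] : y - n.+1%:R^-1 < y + n.+1%:R^-1.
      by rewrite ltrD2l gtrN.
    by rewrite in_itv/= => /andP[h1 h2]; exists q; rewrite ltr_distl h1 h2.
  have [q qx] := rapp x.
  have /choice[w wv] : forall i : 'I_d, exists q : rat,
    `|ratr q - (v : 'rV[R]_d) ord0 i| < n.+1%:R^-1 by move=> i; exact: rapp.
  have Cxv : C (q, \row_i w i, n) (x, v).
    split=> /=; first by rewrite -ball_normE.
    by apply/ball_rV => // i; rewrite !mxE.
  exists (q, \row_i w i, n) => //; rewrite /G asboolT//.
  move=> -[y u] [/= qy wu].
  apply: eU; apply/ball_rV => // i.
  move: wu => /(ball_rV _ _ ngt0) wu.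
  move: qy; rewrite -ball_normE/= => qy.
  have tri (a b c : R) : `|a - b| < n.+1%:R^-1 -> `|a - c| < n.+1%:R^-1 ->
      `|b - c| < e.
    move=> ab ac; apply: le_lt_trans n2; rewrite mulr_natr mulr2n.
    by rewrite (le_trans (ler_distD a _ _))// lerD// ltW// distrC.
  rewrite [in X in X < _]mxE [X in `|_ - X|]mxE.
  case: splitP => j _; first by rewrite (ord1 j) !mxE eqxx !mulr1n; exact: tri qx qy.
  by apply: tri (wv j) _; have := wu j; rewrite !mxE.
apply: countable_bigcupT_measurable => [|k]; first exact: countableP.
rewrite /G; case: ifP => // _; apply: measurableX.
  by apply: open_measurable; exact: ball_open.
by apply: sub_sigma_algebra; exact: ball_open.
Qed.

Lemma uncons_rV_measurable (R : realType) (d : nat) :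
  measurable_fun [set: borel_rV R d.+1] (@uncons_rV R d).
Proof.
apply: measurable_fun_pair.
  apply: (measurability _ (RGenOpens.measurableE R)).
  move=> _ [_ [a [b ->] <-]]; rewrite setTI; apply: sub_sigma_algebra.
  apply: open_comp => [x _|]; last exact: interval_open.
  exact: coord_continuous.
apply: (@measurability _ _ _ (borel_rV R d) _ _ (@open 'rV[R]_d)) => // _ [U oU <-].
rewrite setTI; apply: sub_sigma_algebra.
rewrite openE => x Ux; have /nbhs_ballP[e e0 eU] := open_nbhs_nbhs (conj oU Ux).
apply/nbhs_ballP; exists e => // y /(ball_rV _ _ e0) xy.
by apply: eU; apply/ball_rV => // i; rewrite !mxE; exact: xy.
Qed.

Section lebesgue_step.
Local Open Scope ereal_scope.
Context (R : realType) (d : nat)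
  (m : {sigma_finite_measure set (borel_rV R d) -> \bar R}).

Definition lebesgue_step : set (borel_rV R d.+1) -> \bar R :=
  pushforward (@lebesgue_measure R \x m) (@cons_rV R d).

Let lebesgue_step0 : lebesgue_step set0 = 0.
Proof. by rewrite /lebesgue_step /pushforward preimage_set0 measure0. Qed.

Let preim_measurable A : measurable A -> measurable (@cons_rV R d @^-1` A).
Proof.
by move=> mA; rewrite -[X in measurable X]setTI; exact: cons_rV_measurable.
Qed.

Let lebesgue_step_ge0 A : 0 <= lebesgue_step A.
Proof. exact: (@measure_ge0 _ _ _ (@lebesgue_measure R \x m)). Qed.

Let lebesgue_step_sigma_additive : semi_sigma_additive lebesgue_step.
Proof.
move=> F mF tF mUF; rewrite /lebesgue_step /pushforward preimage_bigcup.
apply: measure_semi_sigma_additive.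
- by move=> n; exact: preim_measurable.
- apply/trivIsetP => /= i j _ _ ij; rewrite -preimage_setI.
  by move/trivIsetP : tF => /(_ _ _ _ _ ij) ->//; rewrite preimage_set0.
- by rewrite -preimage_bigcup; exact: preim_measurable.
Qed.

HB.instance Definition _ := isMeasure.Build _ _ _ lebesgue_step
  lebesgue_step0 lebesgue_step_ge0 lebesgue_step_sigma_additive.

Let lebesgue_step_sigma_finite : sigma_finite setT lebesgue_step.
Proof.
have [F [FT ndF Foo]] := iffLR (sigma_finiteP _ _) (sigma_finiteT (@lebesgue_measure R)).
have [G [GT ndG Goo]] := iffLR (sigma_finiteP _ _) (sigma_finiteT m).
exists (fun n => @uncons_rV R d @^-1` (F n `*` G n)).
  apply/esym; rewrite -subTset => x _.
  have [n _ Fn] : (\bigcup_n F n) (@uncons_rV R d x).1 by rewrite -FT.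
  have [k _ Gk] : (\bigcup_n G n) (@uncons_rV R d x).2 by rewrite -GT.
  exists (maxn n k) => //; split.
    by move: Fn; exact/subsetPset/ndF/leq_maxl.
  by move: Gk; exact/subsetPset/ndG/leq_maxr.
move=> n; have [mF Fn] := Foo n; have [mG Gn] := Goo n; split.
  rewrite -[X in measurable X]setTI; apply: uncons_rV_measurable => //.
  exact: measurableX.
rewrite /lebesgue_step /pushforward -comp_preimage.
rewrite (_ : _ \o _ = id); last by apply/funext => x; exact: cons_rVK.
by rewrite preimage_id product_measure1E// lte_mul_pinfty// ge0_fin_numE.
Qed.

HB.instance Definition _ := Measure_isSigmaFinite.Build _ _ _ lebesgue_step
  lebesgue_step_sigma_finite.

End lebesgue_step.

(* Lebesgue measure on R^d: R^0 is a point of mass 1, and the measure on R^d.+1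
   is the image of the product of the measures on R and R^d under cons_rV.
   lebesgue_rV_box gives its value on boxes, which determines it. *)
Fixpoint lebesgue_rV (R : realType) (d : nat) :
    {sigma_finite_measure set (borel_rV R d) -> \bar R} :=
  match d with
  | 0 => @dirac _ (borel_rV R 0) (0 : 'rV[R]_0) R
  | d'.+1 => lebesgue_step (lebesgue_rV R d')
  end.

Lemma box_measurable (R : realType) (d : nat) (a b : 'I_d -> R) :
  measurable
    ([set x : 'rV[R]_d | forall i, a i <= x ord0 i <= b i] : set (borel_rV R d)).
Proof.
have -> : [set x : 'rV[R]_d | forall i, a i <= x ord0 i <= b i] =
    \bigcap_(i in [set: 'I_d]) (fun x : 'rV[R]_d => x ord0 i) @^-1` `[a i, b i].
  by apply/seteqP; split=> x h i; rewrite /= ?in_itv; first move=> _; exact: h.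
apply: fin_bigcap_measurable => // i _.
rewrite -[X in measurable X]setCK; apply: measurableC.
apply: sub_sigma_algebra; rewrite preimage_setC; apply: open_comp => [x _|].
  exact: coord_continuous.
by apply: closed_openC; exact: itv_closed.
Qed.

Lemma lebesgue_rV_box (R : realType) (d : nat) (a b : 'I_d -> R) :
  (forall i, a i <= b i) ->
  lebesgue_rV R d [set x : 'rV[R]_d | forall i, a i <= x ord0 i <= b i] =
  (\prod_i (b i - a i))%:E.
Proof.
elim: d a b => [|d IH] a b ab.
  by rewrite /= diracE big_ord0 mem_set// => -[].
rewrite /= /lebesgue_step /pushforward.
have -> : @cons_rV R d @^-1`
    [set x : 'rV[R]_d.+1 | forall i, a i <= x ord0 i <= b i] =
    `[a ord0, b ord0] `*` [set x : 'rV[R]_d |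
      forall i, a (lift ord0 i) <= x ord0 i <= b (lift ord0 i)].
  apply/seteqP; split=> -[x v] /=.
    move=> h; split.
      have := h ord0; rewrite in_itv/= mxE; case: splitP => // j _.
      by rewrite (ord1 j) mxE eqxx mulr1n.
    move=> i; have := h (lift ord0 i); rewrite mxE; case: splitP => j.
      by rewrite (ord1 j).
    by move=> /= /eqP; rewrite eqn_add2l => /eqP/val_inj <-.
  rewrite in_itv/= => -[hx hv] i; rewrite mxE; case: splitP => j.
    rewrite (ord1 j) => /= i0; rewrite mxE eqxx mulr1n.
    by rewrite (_ : i = ord0)//; exact/val_inj.
  by move=> ij; rewrite (_ : i = lift ord0 j)//; exact/val_inj.
rewrite product_measure1E//; last exact: box_measurable.
rewrite big_ord_recl EFinM -IH//; congr (_ * _)%E.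
etransitivity; first exact: (@lebesgue_measure_itv R `[a ord0, b ord0]).
rewrite /= lte_fin; case: ltP => // ba.
have -> : b ord0 = a ord0 by apply/eqP; rewrite eq_le ba ab.
by rewrite subrr.
Qed.

(* For d = 0 there is no affine hyperplane, so every set is spanning. *)
Definition affine_hyperplane (R : realType) (d : nat) (H : set 'rV[R]_d) :=
  exists (a : 'cV[R]_d) (b : R), a != 0 /\ H = [set x | x *m a = b%:M].

Definition spanning (R : realType) (d : nat) (A : set 'rV[R]_d) :=
  ~ exists2 H, affine_hyperplane H & A `<=` H.

Definition weakly_nondegenerate (R : realType) (d : nat) (S : set 'rV[R]_d) :=
  forall T : d.+2.-tuple 'rV[R]_d,
    uniq T -> [set` T] `<=` S -> spanning [set` T].

Definition convex_hull (R : realType) (d : nat) (A : set 'rV[R]_d) :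
    set 'rV[R]_d :=
  smallest (@convex_set R 'rV[R]_d) A.

(* Convex polytopes of full dimension d. *)
Definition convex_polytope (R : realType) (d : nat) (Q : set 'rV[R]_d) :=
  exists2 A : set 'rV[R]_d, finite_set A & Q = convex_hull A /\ spanning Q.

Definition generalized_polytope (R : realType) (d : nat) (P : set 'rV[R]_d) :=
  exists (n : nat) (Q : 'I_n -> set 'rV[R]_d),
    (forall i, convex_polytope (Q i)) /\ P = \bigcup_i Q i.

(* A d-dimensional simplex is given by its d + 1 vertices T; these are affinely
   independent exactly when [set` T] is spanning. *)
Definition simplex (R : realType) (d : nat) (T : d.+1.-tuple 'rV[R]_d) :
    set 'rV[R]_d :=
  convex_hull [set` T].

Definition open_simplex (R : realType) (d : nat) (T : d.+1.-tuple 'rV[R]_d) :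
    set 'rV[R]_d :=
  (simplex T)°.

Definition dissection (R : realType) (d : nat) (P : set 'rV[R]_d) (n : nat)
    (T : 'I_n -> d.+1.-tuple 'rV[R]_d) :=
  [/\ forall i, spanning [set` T i],
      trivIset setT (fun i => open_simplex (T i)) &
      closure (\bigcup_i open_simplex (T i)) = P].

Definition polytope_vertex (R : realType) (d : nat) (P : set 'rV[R]_d) :
    set 'rV[R]_d :=
  [set v | forall (n : nat) (T : 'I_n -> d.+1.-tuple 'rV[R]_d),
     dissection P T -> exists i, v \in T i].

Definition polytopes_on (R : realType) (d : nat) (S : set 'rV[R]_d) :
    set (set 'rV[R]_d) :=
  [set P | generalized_polytope P /\ polytope_vertex P `<=` S].

Definition borel_set (R : realType) (d : nat) : Type :=
  {A : set (borel_rV R d) | measurable A}.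

(* Real-valued set functions on the Borel sets form a real vector space, in
   which the finite measures and their linear combinations live. The value is
   finite since P is only ever a bounded set. *)
Definition std_measure (R : realType) (d : nat) (P : set 'rV[R]_d) :
    borel_set R d -> R^o :=
  fun A => fine (lebesgue_rV R d (sval A `&` P)).

Definition linear_span (R : realType) (V : lmodType R) (F : set V) : set V :=
  [set v | exists (n : nat) (c : 'I_n -> R) (f : 'I_n -> V),
     (forall i, F (f i)) /\ v = \sum_i c i *: f i].

Definition polytope_measures (R : realType) (d : nat) (S : set 'rV[R]_d) :
    set (borel_set R d -> R^o) :=
  linear_span [set std_measure P | P in polytopes_on S].

Definition simplex_measures (R : realType) (d : nat) (S : set 'rV[R]_d) :
    set (borel_set R d -> R^o) :=
  linear_span [set std_measure (simplex T) | T in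
    [set T : d.+1.-tuple 'rV[R]_d | spanning [set` T] /\ [set` T] `<=` S]].

(* Main.v *)
Require Import Defs.
From mathcomp Require Import all_boot all_order all_fingroup all_algebra.
From mathcomp Require Import all_classical all_reals all_analysis.
From mathcomp Require Import measurable_realfun ring lra.
Set Implicit Arguments.
Unset Strict Implicit.
Unset Printing Implicit Defensive.
Import Order.TTheory GRing.Theory Num.Theory.
Import numFieldNormedType.Exports.
Local Open Scope ring_scope.

(** Homogeneous coordinates turn a point v of R^d into the row vector
    hat v = (1, v), and a simplex into an invertible matrix M of such rows.
    Its signed indicator, bracket M, takes the value sgn (det M) on the open
    cone spanned by the rows and 0 elsewhere.  All identities between such
    functions hold generically, that is, off finitely many linear hyperplanes;
    since hyperplanes are Lebesgue null, a generic identity between indicators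
    is an identity between measures (std_measure_comb).

    An ordering s of the vertices of a simplex gives the flag F_0 < ... < F_d
    of the spans of its initial segments.  Choose a point P(F) in each
    subspace F that meets the affine chart.  Coning from P(F_d) over the
    facets, then inside each facet, and so on, is a barycentric subdivision
    whose centres may lie anywhere in their flats; with signs it still
    reproduces the simplex (bracket_subdivision):

      bracket M = \sum_s sgn(s) bracket (P F_0, ..., P F_d).

    Let P(F) belong to S whenever F meets S, sum over the simplices of a
    dissection of the polytope, and collect the terms that have the same flag.
    The coefficient of a flag is a sum of signs (flag_weight).  It is also the
    iterated jump of the indicator of the polytope across F_(d-1), ..., F_0,
    and so is the same for all dissections (flag_weight_relation).  If F_0 is
    a point v outside S, then v is not a vertex of the polytope, some
    dissection does not use v, and the coefficient, computed from that
    dissection, is 0.  If F_0 is a point of S, then every F_k meets S and all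
    P(F_k) lie in S.  So the indicator of the polytope is generically a linear
    combination of indicators of simplices with vertices in S
    (vertex_elimination, std_measure_of_dissections).

    Conversely a simplex has itself as a dissection, so its vertices in the
    sense of polytope_vertex are among its d + 1 points
    (simplex_polytopes_on). *)

(** * Generic identities *)

Definition generically (R : realFieldType) (n : nat) (Q : 'rV[R]_n -> Prop) :=
  exists2 hs : seq 'cV[R]_n, all (fun h => h != 0) hs &
    forall x, all (fun h => (x *m h) 0 0 != 0) hs -> Q x.

Section Generically.
Variables (R : realFieldType) (n : nat).
Implicit Types Q : 'rV[R]_n -> Prop.

Lemma generically_mono Q Q' :
  (forall x, Q x -> Q' x) -> generically Q -> generically Q'.
Proof. by move=> QQ' [hs hs0 Qhs]; exists hs => // x /Qhs /QQ'. Qed.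

Lemma generically_true Q : (forall x, Q x) -> generically Q.
Proof. by move=> QT; exists [::]. Qed.

Lemma generically_neq (h : 'cV[R]_n) :
  h != 0 -> generically (fun x => (x *m h) 0 0 != 0).
Proof. by move=> h0; exists [:: h] => /= [|x]; rewrite andbT. Qed.

Lemma generically_and Q Q' :
  generically Q -> generically Q' -> generically (fun x => Q x /\ Q' x).
Proof.
move=> [hs hs0 Qhs] [hs' hs'0 Qhs']; exists (hs ++ hs') => [|x].
  by rewrite all_cat hs0.
by rewrite all_cat => /andP[/Qhs ? /Qhs'].
Qed.

Lemma generically_forall (I : finType) (Q : I -> 'rV[R]_n -> Prop) :
  (forall i, generically (Q i)) -> generically (fun x => forall i, Q i x).
Proof.
move=> genQ; suff: generically (fun x => forall i, i \in enum I -> Q i x).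
  by apply: generically_mono => x Qx i; apply: Qx; rewrite mem_enum.
elim: (enum I) => [|i s IHs]; first exact: generically_true.
apply: generically_mono (generically_and (genQ i) IHs) => x [Qi Qs] j.
by rewrite inE => /predU1P[->|/Qs].
Qed.

End Generically.

(** * Signed indicators of simplicial cones *)

(** The ray t |-> l - t p, t > 0, eventually leaves the positive orthant because
    some p i > 0.  It crosses the i-th wall at t = l i / p i, outwards if p i > 0
    and inwards if p i < 0, so the number of exits minus the number of entries
    is 1 if the ray starts inside and 0 otherwise.  The last hypothesis keeps
    the ray from meeting two walls at once. *)
Lemma ray_orthant_crossings (R : realFieldType) (n : nat) (l p : 'I_n -> R) :
  (exists i, 0 < p i) -> (forall i, l i != 0) ->
  (forall i j, i != j -> p i != 0 -> l i * p j != l j * p i) ->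
  [forall j, 0 < l j]%:R =
  \sum_i Num.sg (p i) *
    ((0 < l i / p i) && [forall j, (j != i) ==> (l i / p i * p j < l j)])%:R.
Proof.
move=> [ip ip_gt0] l_neq0 gen.
pose s i := l i / p i.
pose T i := (0 < s i) && [forall j, (j != i) ==> (s i * p j < l j)].
have inP x j : 0 < p j -> (x * p j < l j) = (x < s j).
  by move=> pj; rewrite ltr_pdivlMr.
have inN x j : p j < 0 -> (x * p j < l j) = (s j < x).
  by move=> pj; rewrite ltr_ndivrMr.
have inj i j : i != j -> p i != 0 -> p j != 0 -> s i != s j.
  move=> ij pi pj; apply: contra (gen i j ij pi) => /eqP sij.
  have -> : l i = s i * p i by rewrite divfK.
  have -> : l j = s j * p j by rewrite divfK.
  by rewrite sij mulrAC.
have s0 i : p i != 0 -> s i != 0.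
  by move=> pi; rewrite mulf_neq0 ?invr_neq0.
(* The ray can leave the orthant only through the first of the walls with p i
   positive, and enter it only through the last of those with p i negative. *)
pose i0 := [arg min_(i < ip | 0 < p i) s i]%O.
have [p0 minb] : 0 < p i0 /\ forall j, 0 < p j -> s i0 <= s j.
  by rewrite /i0; case: Order.TotalTheory.arg_minP => // i pi mi.
have ltb j : 0 < p j -> j != i0 -> s i0 < s j.
  move=> pj ji; rewrite lt_neqAle minb // andbT.
  by apply: inj; [rewrite eq_sym | rewrite gt_eqF | rewrite gt_eqF].
pose Z := [forall j, (p j == 0) ==> (0 < l j)].
have TZ i : T i -> p i != 0 -> Z.
  move=> /andP[_ /forallP h] pi; apply/forallP => j; apply/implyP => /eqP pj.
  have := h j; rewrite pj mulr0; case: eqVneq => // ji.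
  by rewrite -ji pj eqxx in pi.
have TA i : 0 < p i -> T i -> i = i0.
  move=> pi /andP[_ /forallP /(_ i0)]; case: eqVneq => //= ii.
  by rewrite inP // ltNge minb.
have allP0 : [forall j, 0 < l j] -> Z /\ 0 < s i0.
  move=> /forallP h; split; last by rewrite divr_gt0.
  by apply/forallP => j; rewrite h implybT.
rewrite (bigD1 i0) //= -/(s _) -/(T _) gtr0_sg // mul1r.
have [ic pc|noC] := pickP [pred i | p i < 0]; last first.
  rewrite big1 ?addr0 => [|i ii]; last first.
    have := noC i; rewrite inE; case: (sgrP (p i)) => [_ _|pi _|//].
      by rewrite mul0r.
    rewrite -/(s _) -/(T _); case: (boolP (T i)) => [/(TA _ pi) e|]; last by rewrite mulr0.
    by rewrite e eqxx in ii.
  congr ((_ : bool)%:R); apply/idP/idP => [/allP0[Zp b0]|Ti0].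
    rewrite /T b0; apply/forallP => j; apply/implyP => ji.
    have := noC j; rewrite inE; case: (ltgtP (p j) 0) => // pj _.
      by rewrite inP // ltb.
    by move/forallP: Zp => /(_ j); rewrite pj eqxx mulr0.
  have Zp := TZ _ Ti0 (lt0r_neq0 p0); case/andP: (Ti0) => b0 _.
  apply/forallP => j; have := noC j; rewrite inE; case: (ltgtP (p j) 0) => // pj _.
    by rewrite -(mul0r (p j)) inP // (lt_le_trans b0) // minb.
  by move/forallP: Zp => /(_ j); rewrite pj eqxx.
pose i1 := [arg max_(i > ic | p i < 0) s i]%O.
have [p1 maxa] : p i1 < 0 /\ forall j, p j < 0 -> s j <= s i1.
  by rewrite /i1; case: Order.TotalTheory.arg_maxP => // i pi mi.
have lta j : p j < 0 -> j != i1 -> s j < s i1.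
  move=> pj ji; rewrite lt_neqAle maxa // andbT.
  by apply: inj; rewrite // lt_eqF.
have TC i : p i < 0 -> T i -> i = i1.
  move=> pi /andP[_ /forallP /(_ i1)]; case: eqVneq => //= ii.
  by rewrite inN // ltNge maxa.
have i10 : i1 != i0 by apply: contraTneq p0 => <-; rewrite -leNgt ltW.
rewrite (bigD1 i1) //= ltr0_sg // -/(s _) -/(T _) big1 ?addr0 => [|i /andP[ii ij]]; last first.
  case: (sgrP (p i)) => [_|pi|pi]; first by rewrite mul0r.
    rewrite -/(s _) -/(T _); case: (boolP (T i)) => [/(TA _ pi) e|]; last by rewrite mulr0.
    by rewrite e eqxx in ii.
  rewrite -/(s _) -/(T _); case: (boolP (T i)) => [/(TC _ pi) e|]; last by rewrite mulr0.
  by rewrite e eqxx in ij.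
have E0 : T i0 = [&& Z, 0 < s i0 & s i1 < s i0].
  apply/idP/idP => [Ti|/and3P[Zp b0 ab]].
    rewrite (TZ _ Ti) ?gt_eqF //=; case/andP: Ti => -> /forallP /(_ i1).
    by rewrite i10 /= inN.
  rewrite /T b0; apply/forallP => j; apply/implyP => ji.
  case: (ltgtP (p j) 0) => pj.
  - by rewrite inN // (le_lt_trans _ ab) // maxa.
  - by rewrite inP // ltb.
  - by move/forallP: Zp => /(_ j); rewrite pj eqxx mulr0.
have E1 : T i1 = [&& Z, 0 < s i1 & s i1 < s i0].
  apply/idP/idP => [Ti|/and3P[Zp b0 ab]].
    rewrite (TZ _ Ti) ?lt_eqF //=; case/andP: Ti => -> /forallP /(_ i0).
    by rewrite eq_sym i10 /= inP.
  rewrite /T b0; apply/forallP => j; apply/implyP => ji.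
  case: (ltgtP (p j) 0) => pj.
  - by rewrite inN // lta.
  - by rewrite inP // (lt_le_trans ab) // minb.
  - by move/forallP: Zp => /(_ j); rewrite pj eqxx mulr0.
have E2 : [forall j, 0 < l j] = [&& Z, 0 < s i0 & s i1 < 0].
  apply/idP/idP => [h|/and3P[Zp b0 a0]].
    have [-> ->] := allP0 h; move/forallP: h => /(_ i1) h /=.
    by rewrite -inN // mul0r.
  apply/forallP => j; case: (ltgtP (p j) 0) => pj.
  - by rewrite -(mul0r (p j)) inN // (le_lt_trans _ a0) // maxa.
  - by rewrite -(mul0r (p j)) inP // (lt_le_trans b0) // minb.
  - by move/forallP: Zp => /(_ j); rewrite pj eqxx.
rewrite E0 E1 E2; case: (Z) => //=; last by rewrite mulr0 addr0.
have /= := s0 i1 (ltr0_neq0 p1).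
case: (ltgtP (s i1) 0) => // a0 _.
  case: (ltP 0 (s i0)) => b0; rewrite ?mulr0 ?addr0 //=.
  by rewrite (lt_trans a0 b0).
case: (ltP (s i1) (s i0)) => ab; rewrite ?andbF /= ?mulr0 ?addr0 //.
by rewrite (lt_trans a0 ab) mulr1 subrr.
Qed.

Section Bracket.
Variables (R : realFieldType) (n : nat).
Implicit Types (M : 'M[R]_n) (x u w p : 'rV[R]_n) (i : 'I_n).

Definition in_cone M x := [forall j, 0 < (x *m invmx M) 0 j].

Definition bracket M x : R := Num.sg (\det M) * (in_cone M x)%:R.

Lemma bracket_singular M x : M \notin unitmx -> bracket M x = 0.
Proof. by rewrite unitmxE unitfE negbK /bracket => /eqP ->; rewrite sgr0 mul0r. Qed.

Lemma bracketE M u : M \in unitmx ->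
  bracket M (u *m M) = Num.sg (\det M) * [forall j, 0 < u 0 j]%:R.
Proof. by move=> uM; rewrite /bracket /in_cone mulmxK. Qed.

Lemma bracket_row_perm (s : 'S_n) M x :
  bracket (row_perm s M) x = (-1) ^+ s * bracket M x.
Proof.
have [uM|nuM] := boolP (M \in unitmx); last first.
  by rewrite !bracket_singular ?mulr0 // row_permE unitmx_mul unitmx_perm.
have uP : row_perm s M \in unitmx by rewrite row_permE unitmx_mul unitmx_perm.
rewrite -(mulmxKV uM x); set u := x *m _.
have E : col_perm s u *m row_perm s M = u *m M.
  by rewrite mul_row_perm; congr (_ *m _); apply/rowP => j; rewrite !mxE permKV.
rewrite bracketE // -E bracketE // row_permE det_mulmx det_perm sgrM sgrX sgrN1.
rewrite -mulrA; congr (_ * (_ * (_ : bool)%:R)).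
apply/forallP/forallP => h j; last by rewrite mxE.
by have := h (s^-1 j)%g; rewrite mxE permKV.
Qed.

Definition setrow i p M := \matrix_k (if k == i then p else row k M).

Lemma setrow_mul i u M : setrow i (u *m M) M = setrow i u 1%:M *m M.
Proof.
by apply/row_matrixP => k; rewrite row_mul !rowK; case: eqP => // _; rewrite -row_mul mul1mx.
Qed.

Lemma det_setrow1 i u : \det (setrow i u 1%:M) = u 0 i.
Proof.
rewrite (expand_det_row _ i) (bigD1 i) //= big1 => [|j ji].
  have -> : cofactor (setrow i u 1%:M) i i = cofactor 1%:M i i.
    rewrite /cofactor; congr (_ * \det _); apply/matrixP => k l.
    by rewrite !mxE eq_sym (negPf (neq_lift _ _)) !mxE.
  have := congr1 (fun A : 'M[R]_n => A i i) (adj1 R n); rewrite !mxE => ->.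
  by rewrite eqxx !mulr1 addr0.
have -> : cofactor (setrow i u 1%:M) i j = cofactor 1%:M i j.
  rewrite /cofactor; congr (_ * \det _); apply/matrixP => k l.
  by rewrite !mxE eq_sym (negPf (neq_lift _ _)) !mxE.
have := congr1 (fun A : 'M[R]_n => A j i) (adj1 R n); rewrite !mxE => ->.
by rewrite (negPf ji) mulr0.
Qed.

(** In the coordinates given by the rows of M this is Cramer's rule: u and w
    are the coordinates of the new row and of the test point. *)
Lemma bracket_setrow i u w M : M \in unitmx ->
  bracket (setrow i (u *m M) M) (w *m M) = Num.sg (\det M) * (Num.sg (u 0 i) *
    ((0 < w 0 i / u 0 i) &&
     [forall j, (j != i) ==> (w 0 i / u 0 i * u 0 j < w 0 j)])%:R).
Proof.
move=> uM; rewrite setrow_mul.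
have [ui0|ui0] := eqVneq (u 0 i) 0.
  rewrite ui0 sgr0 mul0r mulr0 bracket_singular //.
  by rewrite unitmx_mul unitmxE det_setrow1 ui0 unitr0.
have uN : setrow i u 1%:M *m M \in unitmx.
  by rewrite unitmx_mul unitmxE det_setrow1 unitfE ui0.
pose c := \row_j (if j == i then w 0 i / u 0 i else w 0 j - w 0 i / u 0 i * u 0 j).
have cw : c *m setrow i u 1%:M = w.
  apply/rowP => l; rewrite !mxE (bigD1 i) //= !mxE eqxx.
  have [->|li] := eqVneq l i.
    rewrite big1 ?addr0 => [|k ki]; first by rewrite divfK.
    by rewrite !mxE (negPf ki) !mxE (negPf ki) mulr0.
  rewrite (bigD1 l) //= big1 => [|k /andP[ki kl]].
    by rewrite !mxE (negPf li) !mxE eqxx mulr1 addr0 addrC subrK.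
  by rewrite !mxE (negPf ki) !mxE (negPf kl) mulr0.
rewrite -{1}cw -mulmxA bracketE // det_mulmx det_setrow1 sgrM mulrAC mulrC mulrA -mulrA.
congr (_ * (_ * (_ : bool)%:R)).
apply/forallP/andP => [cpos|[ci /forallP cj] j].
  split; first by have := cpos i; rewrite mxE eqxx.
  apply/forallP => j; apply/implyP => ji; have := cpos j.
  by rewrite mxE (negPf ji) subr_gt0.
by rewrite mxE; case: eqVneq => // ji; have := cj j; rewrite ji subr_gt0.
Qed.

End Bracket.

Lemma row_row_perm (R : Type) m n (s : 'S_m) (A : 'M[R]_(m, n)) i :
  row i (row_perm s A) = row (s i) A.
Proof. by apply/rowP => j; rewrite !mxE. Qed.

(** * The cocycle relation *)

Section Cocycle.
Variables (R : realFieldType) (n : nat) (h : 'cV[R]_n).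
Implicit Types (M : 'M[R]_n) (x u w p : 'rV[R]_n) (i : 'I_n).

Let col_mul m (A : 'M[R]_(m, n)) (B : 'M[R]_n) j : col j (A *m B) = A *m col j B.
Proof. by rewrite !colE mulmxA. Qed.

(** The linear form h cuts out the affine chart h = 1, in which the simplices
    live. *)
Definition affine_rows M := M *m h = const_mx 1.
Definition affine_point p := p *m h = const_mx 1.

Lemma affine_rowsP M : affine_rows M <-> forall i, affine_point (row i M).
Proof.
split=> [Mh i|Mh]; first by rewrite /affine_point -row_mul Mh row_const.
by apply/row_matrixP => i; rewrite row_mul Mh row_const.
Qed.

(** The terms on the right count the walls of the cone of M that the ray from x
    in the direction -p crosses.  The coordinates of p sum to 1, so one of them
    is positive. *)
Lemma bracket_cocycle_unit M p : M \in unitmx -> affine_rows M -> affine_point p ->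
  generically (fun x => bracket M x = \sum_i bracket (setrow i p M) x).
Proof.
move=> uM Mh ph.
have [u pE] : exists u, p = u *m M by exists (p *m invmx M); rewrite mulmxKV.
have u1 : \sum_i u 0 i = 1.
  have : u *m M *m h = const_mx 1 by rewrite -pE.
  rewrite -mulmxA Mh => /rowP /(_ 0); rewrite !mxE => <-.
  by apply: eq_bigr => i _; rewrite mxE mulr1.
have [i ui] : exists i, 0 < u 0 i.
  apply/existsP; apply: contra_eqT u1; rewrite negb_exists => /forallP u0.
  by rewrite lt_eqF // (le_lt_trans _ ltr01) // sumr_le0 // => i _; rewrite leNgt u0.
have colM j : col j (invmx M) != 0.
  apply/eqP => /colP c0; have : (1%:M : 'M[R]_n) j j = 0.
    rewrite -(mulmxV uM) mxE big1 // => k _.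
    by have := c0 k; rewrite !mxE => ->; rewrite mulr0.
  by rewrite mxE eqxx => /eqP; rewrite oner_eq0.
have G1 : generically (fun x => forall j, (x *m col j (invmx M)) 0 0 != 0).
  by apply: generically_forall => j; apply: generically_neq.
(* g i j vanishes at x when the ray meets the walls i and j simultaneously. *)
pose g i j := u 0 j *: col i (invmx M) - u 0 i *: col j (invmx M).
have G2 : generically (fun x => forall i j, i != j -> u 0 i != 0 -> (x *m g i j) 0 0 != 0).
  apply: generically_forall => k; apply: generically_forall => j.
  have [->|kj] := eqVneq k j; first exact: generically_true.
  have [_|uk] := eqVneq (u 0 k) 0; first exact: generically_true.
  apply: (@generically_mono _ _ (fun x => (x *m g k j) 0 0 != 0)) => //.
  apply: generically_neq; apply/eqP => g0.
  have : (M *m g k j) j 0 = 0 by rewrite g0 mulmx0 mxE.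
  rewrite /g mulmxBr -!scalemxAr -!col_mul mulmxV // !mxE eqxx.
  rewrite (eq_sym j) (negPf kj) mulr0 mulr1 sub0r => /eqP.
  by rewrite oppr_eq0 (negPf uk).
apply: generically_mono (generically_and G1 G2) => x [x1 x2].
have [w wx] : exists w, x *m invmx M = w by eexists.
have xE : x = w *m M by rewrite -wx mulmxKV.
have wE j : w 0 j = (x *m col j (invmx M)) 0 0 by rewrite -col_mul wx mxE.
rewrite xE bracketE // pE.
rewrite (@ray_orthant_crossings _ _ (w 0) (u 0)).
- by rewrite mulr_sumr; apply: eq_bigr => j _; rewrite bracket_setrow.
- by exists i.
- by move=> j; rewrite wE x1.
move=> k j kj uk; have := x2 k j kj uk.
rewrite /g mulmxBr -!scalemxAr -!col_mul wx !mxE subr_eq0.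
by rewrite mulrC [w 0 j * _]mulrC.
Qed.

(** The relation is symmetric in the rows of M and p, up to sign.  So when M is
    singular it follows from the invertible case applied to another n of these
    n + 1 vectors, unless all the terms vanish. *)
Lemma bracket_cocycle M p : affine_rows M -> affine_point p ->
  generically (fun x => bracket M x = \sum_i bracket (setrow i p M) x).
Proof.
move=> Mh ph; have [uM|nuM] := boolP (M \in unitmx).
  exact: bracket_cocycle_unit.
have [i uN|noN] := pickP (fun i => setrow i p M \in unitmx); last first.
  apply: generically_true => x; rewrite bracket_singular // big1 // => i _.
  by rewrite bracket_singular // noN.
pose N := setrow i p M.
have Nh : affine_rows N.
  by apply/affine_rowsP => k; rewrite rowK; case: eqP => // _; move/affine_rowsP: Mh.
have Mi : affine_point (row i M) by move/affine_rowsP: Mh.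
apply: generically_mono (bracket_cocycle_unit uN Nh Mi) => x.
rewrite (bigD1 i) //= => NE; rewrite (bigD1 i) //= -/N NE.
have -> : setrow i (row i M) N = M.
  by apply/row_matrixP => k; rewrite !rowK; case: eqP => [->|].
rewrite (bracket_singular x nuM) add0r.
rewrite -big_split /= big1 // => j ji.
have -> : setrow j (row i M) N = row_perm (tperm i j) (setrow j p M).
  apply/row_matrixP => k; rewrite row_row_perm.
  rewrite !rowK; case: tpermP => [->|->|].
  - by rewrite eqxx eq_sym (negPf ji) eqxx.
  - by rewrite eqxx eq_sym (negPf ji).
  - by move=> /eqP/negPf -> /eqP/negPf ->.
by rewrite bracket_row_perm odd_tperm eq_sym ji /= expr1 mulN1r addNr.
Qed.

End Cocycle.

(** * Flags and the barycentric subdivision of a simplex *)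

Section Flag.
Variables (F : fieldType) (n : nat).
Implicit Types (N : 'M[F]_n) (k : 'I_n).

Definition prefix_rows N k : 'M[F]_n := \matrix_(i < n) (if (i <= k)%N then row i N else 0).

(** The spans of the initial segments of rows.  Each is stored as a canonical
    generating matrix, so that equality of flags is plain equality. *)
Definition flag N : {ffun 'I_n -> 'M[F]_n} := [ffun k => <<prefix_rows N k>>%MS].

Lemma row_sub_flag N (i k : 'I_n) : (i <= k)%N -> (row i N <= flag N k)%MS.
Proof.
by move=> ik; rewrite ffunE genmxE (eq_row_sub i) // rowK ik.
Qed.

Lemma flag_sub N k m (B : 'M[F]_(m, n)) :
  (forall i : 'I_n, (i <= k)%N -> (row i N <= B)%MS) -> (flag N k <= B)%MS.
Proof.
move=> NB; rewrite ffunE genmxE; apply/row_subP => i; rewrite rowK.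
by case: ifP => [/NB //|_]; exact: sub0mx.
Qed.

Lemma flag_genmx N k : <<flag N k>>%MS = flag N k.
Proof. by rewrite ffunE genmx_id. Qed.

Lemma eq_flag N N' k : (flag N k == flag N' k)%MS -> flag N k = flag N' k.
Proof. by move=> /eqmxP /eq_genmx; rewrite !flag_genmx. Qed.

Lemma flag_row_perm (t : 'S_n) N k :
  (forall i : 'I_n, ((t i <= k) = (i <= k))%N) -> flag (row_perm t N) k = flag N k.
Proof.
move=> tk; apply: eq_flag; apply/andP; split; apply: flag_sub => i ik.
  by rewrite row_row_perm row_sub_flag // tk.
have := @row_sub_flag (row_perm t N) (t^-1 i)%g k.
by rewrite row_row_perm permKV -tk permKV => /(_ ik).
Qed.

End Flag.

Section Subdivision.
Variables (R : realFieldType) (n : nat) (h : 'cV[R]_n) (M : 'M[R]_n)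
  (P : 'M[R]_n -> 'rV[R]_n).
Hypothesis Mh : affine_rows h M.
Hypothesis flagP : forall (s : 'S_n) k,
  (P (flag (row_perm s M) k) <= flag (row_perm s M) k)%MS /\
  affine_point h (P (flag (row_perm s M) k)).

Definition marked (fl : {ffun 'I_n -> 'M[R]_n}) : 'M[R]_n := \matrix_k P (fl k).

(** The partial subdivision in which only the faces of dimension at least m
    have been coned off: the rows from m on are the chosen centres, the others
    are still vertices. *)
Let part (m : nat) (s : 'S_n) : 'M[R]_n :=
  \matrix_k (if (k < m)%N then row (s k) M else P (flag (row_perm s M) k)).

Let part_affine m s : affine_rows h (part m s).
Proof.
apply/affine_rowsP => k; rewrite rowK; case: ifP => _; last by case: (flagP s k).
by move/affine_rowsP: Mh.
Qed.

(** The centre of the face spanned by the rows up to m lies in the span of these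
    rows, hence substituting it for a later row makes the matrix singular. *)
Let part_singular (m i : 'I_n) (s : 'S_n) x : (m < i)%N ->
  bracket (setrow i (P (flag (row_perm s M) m)) (part m.+1 s)) x = 0.
Proof.
move=> mi; have [sub _] := flagP s m.
have /submxP[c ->] :
    (P (flag (row_perm s M) m) <= prefix_rows (part m.+1 s) m)%MS.
  apply: submx_trans sub _; apply: flag_sub => j jm.
  by rewrite (eq_row_sub j) // !rowK jm ltnS jm row_row_perm.
have -> : prefix_rows (part m.+1 s) m =
    \matrix_(j < n) (if (j <= m)%N then delta_mx 0 j else 0 : 'rV_n) *m part m.+1 s.
  apply/row_matrixP => j; rewrite row_mul !rowK.
  by case: ifP => _; [rewrite -rowE rowK | rewrite mul0mx].
rewrite mulmxA setrow_mul bracket_singular // unitmx_mul negb_and.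
rewrite unitmxE det_setrow1 mxE big1 ?unitr0 // => j _.
rewrite !mxE; case: leqP => jm; rewrite ?mxE ?mulr0 //=.
by have /negPf -> : i != j; [apply: contraTneq jm => <-; rewrite -ltnNge | rewrite ?andbF mulr0].
Qed.

(** Substituting the centre for the i-th vertex, i <= m, gives the next partial
    subdivision for the ordering in which i and m are exchanged: the spans of
    the initial segments of length greater than m do not see the exchange. *)
Let part_swap (m i : 'I_n) (s : 'S_n) : (i <= m)%N ->
  setrow i (P (flag (row_perm s M) m)) (part m.+1 s) =
  row_perm (tperm i m) (part m (tperm i m * s)).
Proof.
move=> im.
have fl (k : 'I_n) : (m <= k)%N ->
    flag (row_perm (tperm i m * s) M) k = flag (row_perm s M) k.
  move=> mk; rewrite row_permM; apply: flag_row_perm => j.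
  by case: tpermP => [->|->|//]; rewrite mk (leq_trans im).
apply/row_matrixP => k; rewrite row_row_perm !rowK permM tpermK.
case: tpermP => [->|->|/eqP ki /eqP km].
- by rewrite eqxx ltnn fl.
- rewrite ltnS leqnn; case: eqVneq => [e|mi].
    by rewrite -e in fl *; rewrite ltnn fl.
  have -> : (i < m)%N by rewrite ltn_neqAle im andbT; apply: contraNneq mi => /val_inj ->.
  by [].
- rewrite (negPf ki) ltnS leq_eqVlt -(inj_eq val_inj) in km *.
  rewrite (negPf km) /=; case: ltnP => // mk.
  by rewrite fl.
Qed.

(** Each partial subdivision is counted once for every ordering of its first m
    vertices; this redundancy gives the factors m.+1 and m`! below. *)
Let Xsum m x := \sum_(s : 'S_n) (-1) ^+ s * bracket (part m s) x.

Let Xsum_step (m : 'I_n) : generically (fun x => Xsum m.+1 x = m.+1%:R * Xsum m x).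
Proof.
have G : generically (fun x => forall s : 'S_n, bracket (part m.+1 s) x =
    \sum_i bracket (setrow i (P (flag (row_perm s M) m)) (part m.+1 s)) x).
  apply: generically_forall => s; apply: bracket_cocycle (part_affine _ _) _.
  by have [] := flagP s m.
apply: generically_mono G => x xG; rewrite /Xsum.
transitivity (\sum_(s : 'S_n) \sum_(i < n | (i <= m)%N)
    (-1) ^+ (tperm i m * s)%g * bracket (part m (tperm i m * s)) x).
  apply: eq_bigr => s _; rewrite xG (bigID (fun i : 'I_n => (i <= m)%N)) /=.
  rewrite [X in _ + X]big1 ?addr0 => [|i]; last by rewrite -ltnNge; exact: part_singular.
  rewrite mulr_sumr; apply: eq_bigr => i im.
  rewrite part_swap // bracket_row_perm mulrA odd_permM signr_addb.
  by rewrite [(-1) ^+ s * _]mulrC.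
rewrite exchange_big /=.
transitivity (\sum_(i < n | (i <= m)%N) \sum_(s : 'S_n) (-1) ^+ s * bracket (part m s) x).
  by apply: eq_bigr => i _; rewrite [RHS](reindex_inj (mulgI (tperm i m))).
rewrite (eq_bigl (fun i : 'I_n => (i < m.+1)%N)) // (big_ord_narrow (ltn_ord m)).
by rewrite sumr_const card_ord mulr_natl.
Qed.

(** Apply the cocycle relation to the faces of dimension n - 1, n - 2, ..., 0 in
    turn, each time with the chosen centre of the face. *)
Lemma bracket_subdivision : generically (fun x => bracket M x =
  \sum_(s : 'S_n) (-1) ^+ s * bracket (marked (flag (row_perm s M))) x).
Proof.
have G : forall m, (m <= n)%N -> generically (fun x => Xsum m x = (m`!)%:R * Xsum 0 x).
  elim=> [_|m IHm mn]; first by apply: generically_true => x; rewrite mul1r.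
  apply: generically_mono (generically_and (IHm (ltnW mn)) (Xsum_step (Ordinal mn))) => x [e1 e2].
  by rewrite e2 e1 factS natrM mulrA.
apply: generically_mono (G n (leqnn n)) => x.
have -> : Xsum n x = (n`!)%:R * bracket M x.
  rewrite /Xsum (eq_bigr (fun=> bracket M x)) => [|s _].
    by rewrite sumr_const card_Sn mulr_natl.
  have -> : part n s = row_perm s M.
    by apply/row_matrixP => k; rewrite rowK ltn_ord row_row_perm.
  by rewrite bracket_row_perm mulrA -signr_addb addbb mul1r.
move/(mulfI _) => ->; last by rewrite pnatr_eq0 -lt0n fact_gt0.
by apply: eq_bigr => s _; congr (_ * bracket _ _); apply/row_matrixP => k; rewrite !rowK.
Qed.

End Subdivision.

(** * The weight of a flag is an iterated jump *)

Section FlagTrig.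
Variables (F : fieldType) (n : nat).
Implicit Types (N E : 'M[F]_n) (k : 'I_n).

Lemma prefix_rowsE N k : prefix_rows N k = prefix_rows 1%:M k *m N.
Proof.
apply/row_matrixP => i; rewrite row_mul !rowK; case: ifP => _.
  by rewrite -row_mul mul1mx.
by rewrite mul0mx.
Qed.

Lemma sub_flagP N k (u : 'rV_n) : N \in unitmx ->
  reflect (forall l : 'I_n, (k < l)%N -> (u *m invmx N) 0 l = 0) (u <= flag N k)%MS.
Proof.
move=> uN; apply: (iffP idP) => [|u0].
  rewrite ffunE genmxE prefix_rowsE => /submxP[c ->] l kl.
  rewrite mulmxA mulmxK // mxE big1 // => j _.
  rewrite !mxE; case: leqP => jk; rewrite ?mxE ?mulr0 //.
  have /negPf -> : j != l by apply: contraTneq kl => <-; rewrite -leqNgt.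
  by rewrite mulr0.
rewrite -(mulmxKV uN u) mulmx_sum_row summx_sub // => l _.
by case: (leqP l k) => [lk|/u0 ->]; rewrite ?scale0r ?sub0mx // scalemx_sub // row_sub_flag.
Qed.

(** When the change of basis is lower triangular, each flat of the first flag
    lies in the corresponding flat of the second, and their ranks agree. *)
Lemma eq_flagP E N : E \in unitmx -> N \in unitmx ->
  reflect (flag E = flag N) (is_trig_mx (E *m invmx N)).
Proof.
move=> uE uN; apply: (iffP is_trig_mxP) => [trig|eEN k l kl].
  have sEN k : (flag E k <= flag N k)%MS.
    apply: flag_sub => i ik; apply/(sub_flagP _ _ uN) => l kl.
    by rewrite -row_mul mxE trig // (leq_ltn_trans ik).
  apply/ffunP => k; apply: eq_flag; rewrite -(geq_leqif (mxrank_leqif_eq (sEN k))).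
  rewrite !ffunE !genmxE (prefix_rowsE E) (prefix_rowsE N).
  by rewrite !mxrankMfree // row_free_unit.
have : (row k E <= flag N k)%MS by rewrite -eEN row_sub_flag.
by move/(sub_flagP _ _ uN)/(_ l kl); rewrite -row_mul mxE.
Qed.

End FlagTrig.

Section LeadingSign.
Variable R : realFieldType.

(** A polynomial has the sign of its lowest term at small positive t. *)
Lemma leading_sign n (c : 'I_n -> R) (k : 'I_n) :
  (forall j : 'I_n, (j < k)%N -> c j = 0) -> c k != 0 ->
  exists2 d : R, 0 < d & forall t, 0 < t < d ->
    Num.sg (\sum_j c j * t ^+ j) = Num.sg (c k).
Proof.
move=> c0 ck; pose C := \sum_j `|c j|.
have C0 : 0 < C.
  by rewrite /C (bigD1 k) //= ltr_pwDl ?normr_gt0 // sumr_ge0.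
exists (Num.min 1 (`|c k| / C)) => [|t /andP[t0]].
  by rewrite lt_min ltr01 divr_gt0 ?normr_gt0.
rewrite lt_min ltr_pdivlMr // => /andP[t1 tC].
have -> : \sum_j c j * t ^+ j =
    t ^+ k * (c k + \sum_(j < n | (k < j)%N) c j * t ^+ (j - k)).
  rewrite mulrDr (bigD1 k) //= mulrC; congr (_ + _).
  rewrite (bigID (fun j : 'I_n => (k < j)%N)) /= [X in _ + X]big1 ?addr0.
    rewrite mulr_sumr; apply: eq_big => [j|j /andP[_ kj]].
      by case: ltnP; rewrite ?andbT ?andbF // => kj; apply: contraTneq kj => ->; rewrite ltnn.
    by rewrite mulrCA -exprD subnKC // ltnW.
  move=> j /andP[jk]; rewrite -leqNgt leq_eqVlt => /predU1P[/val_inj e|/c0 ->].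
    by rewrite e eqxx in jk.
  by rewrite mul0r.
rewrite sgrM gtr0_sg ?exprn_gt0 // mul1r.
set b := \sum_(_ < n | _) _.
have bC : `|b| < `|c k|.
  apply: le_lt_trans tC; rewrite /C mulr_sumr (le_trans (ler_norm_sum _ _ _)) //.
  rewrite [leRHS](bigID (fun j : 'I_n => (k < j)%N)) /= -[leLHS]addr0 lerD //.
    apply: ler_sum => j kj; rewrite normrM [leRHS]mulrC ler_wpM2l //.
    rewrite ger0_norm; last by rewrite exprn_ge0 ?ltW.
    have -> : (j - k = (j - k).-1.+1)%N by rewrite prednK // subn_gt0.
    by rewrite exprS ler_piMr ?(ltW t0) ?exprn_ile1 ?(ltW t0) ?(ltW t1).
  by rewrite sumr_ge0 // => j _; rewrite mulr_ge0 // ltW.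
move: bC ck; case: (ltgtP (c k) 0) => // ck bC _.
  rewrite (ltr0_norm ck) in bC; rewrite (ltr0_sg ck); apply: ltr0_sg.
  by have := ler_norm b; lra.
rewrite (gtr0_norm ck) in bC; rewrite (gtr0_sg ck); apply: gtr0_sg.
by have := lerNnormlW (lexx `|b|); lra.
Qed.

Lemma leading_sign_all n (cs : seq {ffun 'I_n -> R}) :
  exists2 t : R, 0 < t & forall (c : {ffun 'I_n -> R}) (k : 'I_n), c \in cs ->
    (forall j : 'I_n, (j < k)%N -> c j = 0) -> c k != 0 ->
    Num.sg (\sum_j c j * t ^+ j) = Num.sg (c k).
Proof.
suff [d d0 dP] : exists2 d : R, 0 < d & forall t, 0 < t < d ->
    forall (c : {ffun 'I_n -> R}) (k : 'I_n), c \in cs ->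
    (forall j : 'I_n, (j < k)%N -> c j = 0) -> c k != 0 ->
    Num.sg (\sum_j c j * t ^+ j) = Num.sg (c k).
  by exists (d / 2) => [|c k]; [lra|apply: dP; lra].
elim: cs => [|c cs [d d0 IH]]; first by exists 1.
have [k0|none] := pickP (fun k => (c k != 0) && [forall j : 'I_n, (j < k)%N ==> (c j == 0)]).
  move=> /andP[ck0 /forallP lk0].
  have c0 (j : 'I_n) : (j < k0)%N -> c j = 0 by move=> jk; apply/eqP; move/implyP: (lk0 j) => ->.
  have [d' d'0 d'P] := leading_sign c0 ck0.
  exists (Num.min d d') => [|t]; first by rewrite lt_min d0.
  rewrite lt_min => /and3P[t0 td td'] e k; rewrite inE => /predU1P[->|ecs]; last first.
    by apply: IH; rewrite // t0.
  move=> e0 ek; have -> : k = k0.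
    apply/val_inj; case: (ltngtP k k0) => // kk; first by rewrite c0 ?eqxx in ek.
    by rewrite e0 ?eqxx in ck0.
  by apply: d'P; rewrite t0.
exists d => // t td e k; rewrite inE => /predU1P[->|ecs]; last exact: IH.
move=> e0 ek; have := none k; rewrite ek /=; case: forallP => // -[] j.
by apply/implyP => /e0 ->.
Qed.

End LeadingSign.

Section Jump.
Variables (R : realFieldType) (n : nat).
Implicit Types (E M : 'M[R]_n) (e : {ffun 'I_n -> bool}).

(** For small t > 0 and varying signs e these 2^n points lie around the flag of
    E, one in each chamber that the flag cuts out: as the powers of t have
    different orders of magnitude, the sign of a linear form there is decided
    by the first row of E on which the form does not vanish. *)
Definition near_flag E (t : R) e : 'rV_n := \row_k ((-1) ^+ e k * t ^+ k) *m E.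

(** The coefficient of the flag in the subdivision of M, up to the orientation
    of the flag: a sum with at most one term. *)
Definition flag_weight M (fl : {ffun 'I_n -> 'M[R]_n}) : R :=
  \sum_(s : 'S_n | flag (row_perm s M) == fl) Num.sg (\det (row_perm s M)).

(** The iterated difference, over all the steps of the flag of E, of the
    indicator of the cone of M. *)
Definition jump E M t := \sum_(e : {ffun 'I_n -> bool}) (\prod_k (-1) ^+ e k) *
  (in_cone M (near_flag E t e))%:R : R.

(** The hypothesis says that t is small enough.
    Let kf j be the first row of E on which the j-th coordinate form of M does
    not vanish; membership in the cone only tests the signs e (kf j).  If kf
    misses some k, flipping e k preserves membership and reverses the sign of
    the term, so the jump is 0, and no ordering of M has the flag of E.
    Otherwise kf is a permutation, exactly one choice of signs lies in the
    cone, the inverse of kf is the only ordering of M with the flag of E, and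
    the change of basis from that ordering to E is triangular. *)
Lemma jump_in_cone E M t : E \in unitmx -> M \in unitmx ->
  (forall e (j k : 'I_n),
    (forall l : 'I_n, (l < k)%N -> (E *m invmx M) l j = 0) ->
    (E *m invmx M) k j != 0 ->
    Num.sg ((near_flag E t e *m invmx M) 0 j) =
    Num.sg ((-1) ^+ e k * (E *m invmx M) k j)) ->
  jump E M t = Num.sg (\det E) * flag_weight M (flag E).
Proof.
move=> uE uM; have [L eL] : exists L, E *m invmx M = L by eexists.
have EL : E = L *m M by rewrite -eL mulmxKV.
have uL : L \in unitmx by rewrite -eL unitmx_mul uE unitmx_inv.
rewrite eL => lead.
have colL j : exists k, (L k j != 0) && [forall l : 'I_n, (l < k)%N ==> (L l j == 0)].
  have [k0 Lk0] : exists k, L k j != 0.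
    apply/existsP; apply: contraTT uL; rewrite negb_exists => /forallP Lj0.
    rewrite unitmxE (expand_det_col _ j) big1 ?unitr0 // => k _.
    by move: (Lj0 k); rewrite negbK => /eqP ->; rewrite mul0r.
  have [k Lk mk] := @arg_minnP _ k0 (fun k => L k j != 0) (fun k => val k) Lk0.
  exists k; rewrite Lk; apply/forallP => l; apply/implyP => lk.
  by apply: contraLR lk; rewrite -leqNgt; exact: mk.
have [kf kfP] : exists kf : 'I_n -> 'I_n, forall j, L (kf j) j != 0 /\
    forall l : 'I_n, (l < kf j)%N -> L l j = 0.
  exists (fun j => xchoose (colL j)) => j.
  have /andP[-> /forallP h] := xchooseP (colL j); split=> // l lk.
  by apply/eqP; move/implyP: (h l) => ->.
have coneE e : in_cone M (near_flag E t e) = [forall j, e (kf j) == (L (kf j) j < 0)].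
  apply: eq_forallb => j; have [Lj lj0] := kfP j.
  rewrite -sgr_gt0 (lead _ _ _ lj0) // sgr_gt0.
  case: (e _); rewrite ?expr0 ?expr1 ?mul1r ?mulN1r ?oppr_gt0.
    by case: (L _ _ < 0).
  by move: Lj; case: (ltgtP (L _ _) 0).
have LsE s : E *m invmx (row_perm s M) = col_perm s L.
  have uP : row_perm s M \in unitmx by rewrite row_permE unitmx_mul unitmx_perm.
  apply: (canLR (mulmxK uP)); rewrite EL mul_row_perm; congr (_ *m _).
  by apply/matrixP => i j; rewrite !mxE permKV.
have flP s : flag (row_perm s M) = flag E -> forall l, kf (s l) = l.
  have uP : row_perm s M \in unitmx by rewrite row_permE unitmx_mul unitmx_perm.
  move/esym/(eq_flagP uE uP)/is_trig_mxP.
  rewrite LsE.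
  move=> trig l; apply/val_inj.
  have [Lk lk0] := kfP (s l).
  case: (ltngtP (kf (s l)) l) => // kl.
    by move: (trig _ _ kl); rewrite mxE => /eqP; rewrite (negPf Lk).
  have tr : is_trig_mx (col_perm s L) by apply/is_trig_mxP.
  have : \det (col_perm s L) != 0.
    by rewrite col_permE det_mulmx det_perm mulf_neq0 ?signr_eq0 // -unitfE -unitmxE.
  rewrite (det_trig tr) => /prodf_neq0 /(_ l isT).
  by rewrite mxE lk0 ?eqxx.
rewrite /jump; have [/forallP surb|] :=
    boolP [forall k, [exists j, kf j == k]]; last first.
  rewrite negb_forall => /existsP[k]; rewrite negb_exists => /forallP nok.
  have -> : flag_weight M (flag E) = 0.
    apply: big1 => s /eqP sE; have sk := flP _ sE k.
    by move: (nok (s k)); rewrite sk eqxx.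
  rewrite mulr0; pose flip e : {ffun 'I_n -> bool} := [ffun l => e l (+) (l == k)].
  have flipK : involutive flip.
    by move=> e; apply/ffunP => l; rewrite !ffunE addbK.
  set J := (LHS); have JN : J = - J.
    rewrite {1}/J (reindex_inj (inv_inj flipK)) /= /J -sumrN.
    apply: eq_bigr => e _; rewrite -mulNr; congr (_ * _).
      rewrite (bigD1 k) //= [in RHS](bigD1 k) //= ffunE eqxx addbT signrN mulNr.
      congr (- (_ * _)); apply: eq_bigr => l lk.
      by rewrite ffunE (negPf lk) addbF.
    congr ((_ : bool)%:R); rewrite !coneE; apply: eq_forallb => j.
    by rewrite ffunE (negPf (nok j)) addbF.
  by move: JN => /eqP; rewrite -addr_eq0 -mulr2n mulrn_eq0 => /eqP.
have sur k : exists j, kf j == k by apply/existsP.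
have gK : cancel (fun k => xchoose (sur k)) kf.
  by move=> k; apply/eqP; apply: (xchooseP (sur k)).
pose s := perm (can_inj gK).
have kfs l : kf (s l) = l by rewrite permE gK.
have skf j : s (kf j) = j by rewrite -[j in LHS](permKV s) kfs permKV.
have uniq_s s' : (flag (row_perm s' M) == flag E) = (s' == s).
  apply/eqP/eqP => [sE|->].
    by apply/permP => l; rewrite -(skf (s' l)) flP.
  apply/esym/eq_flagP => //; first by rewrite row_permE unitmx_mul unitmx_perm.
  rewrite LsE; apply/is_trig_mxP => k l kl; rewrite mxE.
  by have [_ ->] := kfP (s l); rewrite ?kfs.
rewrite /flag_weight (eq_bigl _ _ uniq_s) big_pred1_eq.
rewrite (bigD1 [ffun k => L k (s k) < 0]) //= [X in _ + X]big1 ?addr0 => [|e eN]; last first.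
  rewrite coneE; case: forallP => [e_eq|]; last by rewrite mulr0.
  case/eqP: eN; apply/ffunP => k; rewrite ffunE.
  by have /eqP := e_eq (s k); rewrite kfs.
rewrite coneE; have -> : [forall j, [ffun k => L k (s k) < 0] (kf j) == (L (kf j) j < 0)].
  by apply/forallP => j; rewrite ffunE skf.
have -> : \det E = \det (col_perm s L) * \det (row_perm s M).
  rewrite -det_mulmx; congr (\det _); rewrite EL mul_row_perm; congr (_ *m _).
  by apply/matrixP => i j; rewrite !mxE permKV.
have tr : is_trig_mx (col_perm s L).
  apply/is_trig_mxP => k l kl; rewrite mxE.
  by have [_ ->] := kfP (s l); rewrite ?kfs.
have detN : \det (row_perm s M) != 0.
  by rewrite -unitfE -unitmxE row_permE unitmx_mul unitmx_perm.
rewrite (det_trig tr) sgrM -mulrA -expr2 sqr_sg detN !mulr1.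
rewrite (big_morph _ (@sgrM R) (@sgr1 R)); apply: eq_bigr => k _.
rewrite ffunE mxE; have [+ _] := kfP (s k); rewrite kfs.
by case: (sgrP (L k (s k))).
Qed.

End Jump.

Section Relation.
Variables (R : realFieldType) (n : nat).
Implicit Types (E M : 'M[R]_n).

(** The jump is linear in the function, and the points used to compute it avoid
    any given finite set of hyperplanes when t is small enough. *)
Lemma flag_weight_relation (I : finType) (c : I -> R) (M : I -> 'M[R]_n) E :
  E \in unitmx -> (forall i, M i \in unitmx) ->
  generically (fun x => \sum_i c i * (in_cone (M i) x)%:R = 0) ->
  \sum_i c i * flag_weight (M i) (flag E) = 0.
Proof.
move=> uE uM [hs hs0 hsP].
pose hs' := hs ++ [seq col j (invmx (M i)) | i <- enum I, j <- enum 'I_n].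
pose cf (e : {ffun 'I_n -> bool}) (g : 'cV[R]_n) : {ffun 'I_n -> R} :=
  [ffun k => (-1) ^+ e k * (E *m g) k 0].
have [t t0 tP] := leading_sign_all
  [seq cf e g | e <- enum {ffun 'I_n -> bool}, g <- hs'].
have near_mul e (g : 'cV[R]_n) : (near_flag E t e *m g) 0 0 = \sum_j cf e g j * t ^+ j.
  rewrite -mulmxA mxE; apply: eq_bigr => j _.
  by rewrite [X in X * _]mxE ffunE mulrAC.
have lead e g (k : 'I_n) : g \in hs' -> (forall l : 'I_n, (l < k)%N -> (E *m g) l 0 = 0) ->
    (E *m g) k 0 != 0 ->
    Num.sg ((near_flag E t e *m g) 0 0) = Num.sg ((-1) ^+ e k * (E *m g) k 0).
  move=> ghs g0 gk; rewrite near_mul (tP _ k) ?ffunE //.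
  - by apply/allpairsP; exists (e, g); rewrite mem_enum.
  - by move=> l /g0 l0; rewrite ffunE l0 mulr0.
  - by rewrite mulf_neq0 ?signr_eq0.
(* The points are generic, so the hypothesis holds at each of them. *)
have zero e : \sum_i c i * (in_cone (M i) (near_flag E t e))%:R = 0.
  apply: hsP; apply/allP => g ghs; have g0 := allP hs0 _ ghs.
  have [k0 Egk0] : exists k, (E *m g) k 0 != 0.
    apply/existsP; apply: contraTT g0; rewrite negb_exists negbK => /forallP Eg0.
    rewrite -(mulKmx uE g); apply/eqP; suff -> : E *m g = 0 by rewrite mulmx0.
    by apply/colP => k; move: (Eg0 k); rewrite negbK [RHS]mxE => /eqP.
  have [k gk mk] := @arg_minnP _ k0 (fun k => (E *m g) k 0 != 0) (fun k => val k) Egk0.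
  rewrite -sgr_eq0 (lead _ _ k) //.
  - by rewrite sgr_eq0 mulf_neq0 ?signr_eq0.
  - by rewrite mem_cat ghs.
  - by move=> l; apply: contraTeq; rewrite -leqNgt; exact: mk.
have Jz : \sum_i c i * (Num.sg (\det E) * flag_weight (M i) (flag E)) = 0.
  transitivity (\sum_(e : {ffun 'I_n -> bool}) (\prod_k (-1) ^+ e k) *
     \sum_i c i * (in_cone (M i) (near_flag E t e))%:R : R); last first.
    by apply: big1 => e _; rewrite zero mulr0.
  under [RHS]eq_bigr do rewrite mulr_sumr.
  rewrite exchange_big /=; apply: eq_bigr => i _.
  rewrite -(@jump_in_cone _ _ _ _ t) // => [|e j k l0 kj].
    by rewrite mulr_sumr; apply: eq_bigr => e _; rewrite mulrCA.
  have colE (m : nat) (A : 'M[R]_(m, n)) a b :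
      (A *m invmx (M i)) a b = (A *m col b (invmx (M i))) a 0.
    by rewrite !mxE; apply: eq_bigr => ? _; rewrite !mxE.
  rewrite !colE; apply: lead.
  - by rewrite mem_cat; apply/orP; right; apply/allpairsP; exists (i, j); rewrite !mem_enum.
  - by move=> l /l0; rewrite colE.
  - by rewrite -colE.
have : Num.sg (\det E) * \sum_i c i * flag_weight (M i) (flag E) = 0.
  by rewrite mulr_sumr -[RHS]Jz; apply: eq_bigr => i _; rewrite mulrCA.
by move/eqP; rewrite mulf_eq0 sgr_eq0 -[_ == 0]negbK -unitfE -unitmxE uE => /eqP.
Qed.

End Relation.

Lemma sum_grouped_eq0 (R : pzRingType) (I : finType) (K : eqType) (key : I -> K)
    (B : pred I) (w : I -> R) (G : K -> R) :
  (forall a, B a -> \sum_(b | B b && (key b == key a)) w b = 0) ->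
  \sum_(a | B a) w a * G (key a) = 0.
Proof.
move=> w0; pose r a := odflt a [pick b | key b == key a].
have rP a b : (r a == r b) = (key a == key b).
  have rk c : key (r c) = key c.
    by rewrite /r; case: pickP => [d /eqP|/(_ c)]; rewrite //= eqxx.
  apply/eqP/eqP => [e|e]; first by rewrite -rk e rk.
  rewrite /r e; case: pickP => // /(_ b); by rewrite eqxx.
rewrite (partition_big r xpredT) //= big1 // => j _.
have [a /andP[Ba /eqP raj]|none] := pickP [pred a | B a && (r a == j)]; last first.
  by rewrite big_pred0.
rewrite (eq_bigr (fun b => w b * G (key a))) => [|b /andP[_]]; last first.
  by rewrite -raj rP => /eqP ->.
rewrite -mulr_suml (eq_bigl (fun b => B b && (key b == key a))) ?w0 ?mul0r // => b.
by rewrite -raj rP.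
Qed.

(** * Eliminating vertices *)

Section Elimination.
Variables (R : realFieldType) (n : nat) (h : 'cV[R]_n.+1).
Implicit Types (E M N : 'M[R]_n.+1).

Lemma in_cone_bracket M x : M \in unitmx ->
  (in_cone M x)%:R = Num.sg (\det M) * bracket M x.
Proof.
rewrite unitmxE unitfE /bracket => M0.
by rewrite mulrA -expr2 sqr_sg M0 mul1r.
Qed.

Lemma eq_flag_row0 E N : affine_rows h E -> affine_rows h N ->
  flag E = flag N -> row 0 E = row 0 N.
Proof.
move=> /affine_rowsP Eh /affine_rowsP Nh eEN.
have /sub_rVP[a eE] : (row 0 E <= row 0 N)%MS.
  apply: (@submx_trans _ _ _ _ _ _ (flag N 0)); first by rewrite -eEN row_sub_flag.
  apply: flag_sub => i; rewrite leqn0 => /eqP i0.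
  by have -> : i = 0 by apply/val_inj.
have := Eh 0; rewrite /affine_point eE -scalemxAl Nh => /rowP/(_ 0).
by rewrite !mxE mulr1 => ->; rewrite scale1r.
Qed.

Lemma affine_rows_perm (s : 'S_n.+1) M : affine_rows h M -> affine_rows h (row_perm s M).
Proof. by move=> /affine_rowsP Mh; apply/affine_rowsP => i; rewrite row_row_perm. Qed.

(** Subdivide with centres in S where possible.  The terms whose flag starts at
    a point v outside S cancel, by comparison with the decomposition that
    avoids v; that decomposition may change with v, while the combination
    obtained here serves for all v at once. *)
Lemma vertex_elimination (S : set 'rV[R]_n.+1) (I : finType) (M : I -> 'M[R]_n.+1) :
  (forall i, M i \in unitmx /\ affine_rows h (M i)) ->
  (forall v, affine_point h v -> ~ S v ->
     exists (J : finType) (N : J -> 'M[R]_n.+1),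
       (forall j, [/\ N j \in unitmx, affine_rows h (N j) & forall k, row k (N j) != v]) /\
       generically (fun x =>
         \sum_i (in_cone (M i) x)%:R = \sum_j (in_cone (N j) x)%:R :> R)) ->
  exists (K : finType) (c : K -> R) (N : K -> 'M[R]_n.+1),
    (forall k, c k != 0 -> N k \in unitmx /\ forall i, S (row i (N k))) /\
    generically (fun x => \sum_i (in_cone (M i) x)%:R =
                          \sum_k c k * (in_cone (N k) x)%:R).
Proof.
move=> MP avoid.
have uM i : M i \in unitmx by case: (MP i).
have Mh i : affine_rows h (M i) by case: (MP i).
(* P F is a point of S in F if there is one, and otherwise any point of F. *)
pose A (F : 'M[R]_n.+1) : set 'rV[R]_n.+1 := fun v => (v <= F)%MS /\ affine_point h v.
pose P F := xget (xget 0 (A F)) (fun v => A F v /\ S v).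
have PA F : (exists v, A F v) -> A F (P F).
  move=> AF; rewrite /P; case: xgetP => [v _ []//|_].
  by case: AF => v; exact: xgetI.
have PS F v : A F v -> S v -> S (P F).
  by move=> AFv Sv; rewrite /P; case: xgetP => [u _ []//|/(_ v)[]].
have Arow (i : I) (s : 'S_n.+1) k : A (flag (row_perm s (M i)) k) (row (s 0) (M i)).
  split; last by move: (s 0); apply/affine_rowsP.
  by rewrite -row_row_perm row_sub_flag.
pose key (a : I * 'S_n.+1) := flag (row_perm a.2 (M a.1)).
pose w (a : I * 'S_n.+1) : R := Num.sg (\det (row_perm a.2 (M a.1))).
pose good (a : I * 'S_n.+1) := `[< S (row (a.2 0) (M a.1)) >].
pose N a := marked P (key a).
exists (I * 'S_n.+1)%type, (fun a => if good a then w a * Num.sg (\det (N a)) else 0), N.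
split=> [[i s]|].
  case: ifP => [/asboolP Sv|]; last by rewrite eqxx.
  rewrite mulf_eq0 negb_or => /andP[_]; rewrite sgr_eq0 => detN.
  split=> [|k]; first by rewrite unitmxE unitfE.
  by rewrite rowK; apply: PS (Arow i s k) Sv.
have sub i : generically (fun x => bracket (M i) x =
    \sum_(s : 'S_n.+1) (-1) ^+ s * bracket (N (i, s)) x).
  apply: bracket_subdivision (Mh i) _ => s k.
  by have [] := PA _ (ex_intro _ _ (Arow i s k)).
apply: generically_mono (generically_forall sub) => x {}sub.
transitivity (\sum_a w a * bracket (N a) x).
  transitivity (\sum_i \sum_s w (i, s) * bracket (N (i, s)) x).
    apply: eq_bigr => i _; rewrite in_cone_bracket // sub mulr_sumr.
    apply: eq_bigr => s _; rewrite mulrA; congr (_ * _).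
    by rewrite /w /= row_permE det_mulmx det_perm sgrM sgrX sgrN1 mulrC.
  by rewrite pair_bigA; apply: eq_bigr => -[].
rewrite (bigID good) /= [X in _ + X](_ : _ = 0) ?addr0; last first.
  apply: (@sum_grouped_eq0 _ _ _ key _ _ (fun fl => bracket (marked P fl) x)) => a bad_a.
  case: a bad_a => i s bad_a.
  pose E := row_perm s (M i).
  have uE : E \in unitmx by rewrite /E row_permE unitmx_mul unitmx_perm uM.
  have Eh : affine_rows h E by exact: affine_rows_perm.
  transitivity (\sum_j flag_weight (M j) (flag E)).
    rewrite /flag_weight pair_big_dep /=; apply: eq_bigl => -[j t] /=.
    apply: andb_idl => /eqP e; rewrite /good /=.
    have := eq_flag_row0 (affine_rows_perm t (Mh j)) Eh e.
    by rewrite !row_row_perm => ->.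
  have Ev : affine_point h (row 0 E) by move/affine_rowsP: Eh; exact.
  have [|J [N' [N'P N'x]]] := avoid _ Ev.
    by rewrite row_row_perm => Sv; case/negP: bad_a; apply/asboolP.
  (* The difference of the two decompositions vanishes generically, and the
     second has no simplex with a flag that starts at this point. *)
  pose c (k : I + J) : R := if k is inl _ then 1 else -1.
  pose MN (k : I + J) := match k with inl i => M i | inr j => N' j end.
  have := @flag_weight_relation _ _ (I + J)%type c MN E uE.
  rewrite !big_sumType /= => rel.
  have : \sum_i flag_weight (M i) (flag E) - \sum_j flag_weight (N' j) (flag E) = 0.
    rewrite -sumrN; under eq_bigr do rewrite -[flag_weight _ _]mul1r.
    under [X in _ + X]eq_bigr do rewrite -mulN1r.
    apply: rel => [[k|j]|]; first exact: uM; first by case: (N'P j).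
    apply: generically_mono N'x => y Ny; rewrite big_sumType /=.
    under eq_bigr do rewrite mul1r.
    by under [X in _ + X]eq_bigr do rewrite mulN1r; rewrite sumrN Ny subrr.
  rewrite [X in _ - X]big1 ?subr0 // => j _; apply: big1 => t /eqP e.
  have [_ N'h /(_ (t 0))] := N'P j.
  by rewrite -row_row_perm (eq_flag_row0 (affine_rows_perm t N'h) Eh e) eqxx.
rewrite big_mkcond /=; apply: eq_bigr => a _; case: ifP => _; last by rewrite mul0r.
by rewrite -mulrA.
Qed.

End Elimination.

Local Open Scope classical_set_scope.

(** * Hyperplanes are Lebesgue null *)

Section Hat.
Variables (R : realType).

Definition hat d (x : 'rV[R]_d) : 'rV[R]_d.+1 := row_mx (1%:M : 'M[R]_1) x.

(** Affine functions on R^d as linear forms in homogeneous coordinates. *)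
Definition aff d (g : 'cV[R]_d.+1) (x : 'rV[R]_d) : R := (hat x *m g) 0 0.

Lemma row_cons0 d (a : R) (x : 'rV[R]_d) :
  (row_mx (a%:M : 'M[R]_1) x : 'rV[R]_d.+1) 0 0 = a.
Proof. by rewrite mxE; case: splitP => // j _; rewrite (ord1 j) mxE. Qed.

Lemma row_consS d (a : R) (x : 'rV[R]_d) i :
  (row_mx (a%:M : 'M[R]_1) x : 'rV[R]_d.+1) 0 (lift ord0 i) = x 0 i.
Proof.
rewrite mxE; case: splitP => j; first by rewrite (ord1 j).
by move=> /= /eqP; rewrite eqn_add2l => /eqP/val_inj <-.
Qed.

Lemma hat0 d (x : 'rV[R]_d) : hat x 0 0 = 1.
Proof. exact: row_cons0. Qed.

Lemma hatS d (x : 'rV[R]_d) i : hat x 0 (lift ord0 i) = x 0 i.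
Proof. exact: row_consS. Qed.

Lemma affE d (g : 'cV[R]_d.+1) x :
  aff g x = g 0 0 + \sum_i x 0 i * g (lift ord0 i) 0.
Proof.
rewrite /aff mxE big_ord_recl hat0 mul1r; congr (_ + _).
by apply: eq_bigr => i _; rewrite hatS.
Qed.

Lemma continuous_affine_comb (T : topologicalType) (I : Type) (a : R) (b : I -> R)
    (f : I -> T -> R) (s : seq I) : (forall i, continuous (f i)) ->
  continuous (fun x => a + \sum_(i <- s) f i x * b i).
Proof.
move=> cf; elim: s => [|i s IH] x.
  rewrite (_ : (fun _ => _) = cst a); first exact: cvg_cst.
  by apply/funext => y; rewrite big_nil addr0.
rewrite (_ : (fun _ => _) =
  (fun y => f i y * b i) \+ (fun y => a + \sum_(i <- s) f i y * b i)); last first.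
  by apply/funext => y; rewrite big_cons /= addrCA.
by apply: cvgD; [apply: cvgMr_tmp; exact: cf|exact: IH].
Qed.

Lemma aff_continuous d (g : 'cV[R]_d.+1) : continuous (aff g).
Proof.
have -> : aff g = fun x => g 0 0 + \sum_i x 0 i * g (lift ord0 i) 0.
  by apply/funext => x; exact: affE.
by apply: continuous_affine_comb => i; exact: coord_continuous.
Qed.

Lemma hyperplane_measurable d (g : 'cV[R]_d.+1) :
  measurable ([set x | aff g x = 0] : set (borel_rV R d)).
Proof.
rewrite -[X in measurable X]setCK; apply: measurableC; apply: sub_sigma_algebra.
apply: closed_openC; have -> : [set x | aff g x = 0] = aff g @^-1` [set 0] by [].
apply: preimage_closed; last exact: closed_eq.
by move=> x _; exact: aff_continuous.
Qed.

(** Induction on the dimension: the slice over x is a hyperplane whose form has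
    constant coefficient g 0 + x g 1.  This form vanishes for at most one x,
    namely x0, and a single point of R is null. *)
Lemma hyperplane_null d (g : 'cV[R]_d.+1) : g != 0 ->
  lebesgue_rV R d [set x | aff g x = 0] = 0%E.
Proof.
elim: d g => [|d IH] g g0.
  rewrite (_ : [set x | _] = set0) ?measure0 //.
  apply/seteqP; split=> // x; rewrite /= affE big_ord0 addr0 => gz.
  case/eqP: g0; apply/colP => i; rewrite mxE.
  by have -> : i = 0 by apply/val_inj; case: i => -[].
pose A := @cons_rV R d @^-1` [set x | aff g x = 0].
pose tl x : 'cV[R]_d.+1 :=
  \col_i (if unlift ord0 i is Some j then g (lift ord0 (lift ord0 j)) 0
          else g 0 0 + x * g (lift ord0 0) 0).
have tl0 x : tl x 0 0 = g 0 0 + x * g (lift ord0 0) 0 by rewrite mxE unlift_none.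
have tlS x i : tl x (lift ord0 i) 0 = g (lift ord0 (lift ord0 i)) 0.
  by rewrite mxE liftK.
have affA x (v : 'rV[R]_d) : aff g (cons_rV (x, v) : 'rV[R]_d.+1) = aff (tl x) v.
  rewrite !affE big_ord_recl tl0 addrA; congr (_ + _ * _ + _); first exact: row_cons0.
  by apply: eq_bigr => i _; rewrite tlS; congr (_ * _); exact: row_consS.
have secA x : xsection A x = [set v | aff (tl x) v = 0].
  by apply/seteqP; split=> v; rewrite /xsection /= inE /A /= affA.
have mA : measurable A.
  rewrite -[A]setTI; apply: cons_rV_measurable => //; exact: hyperplane_measurable.
rewrite /= /lebesgue_step /pushforward -/A /product_measure1.
pose x0 : R := - g 0 0 / g (lift ord0 0) 0.
rewrite (@ge0_ae_eq_integral _ _ _ lebesgue_measure setT _ (cst 0%E)) //.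
- by rewrite integral_cst // mul0e.
- exact: measurable_fun_xsection.
exists [set x0]; split => //; first exact: lebesgue_measure_set1.
move=> x /= nx; apply/eqP; apply: contra_notT nx => xx0 _.
rewrite secA; apply: IH; apply: contra g0 => /eqP tx0.
have gS i : g (lift ord0 (lift ord0 i)) 0 = 0 by rewrite -(tlS x) tx0 mxE.
have : g 0 0 + x * g (lift ord0 0) 0 = 0 by rewrite -tl0 tx0 mxE.
have [g1|g1 gx] := eqVneq (g (lift ord0 0) 0) 0.
  rewrite g1 mulr0 addr0 => g00; apply/eqP/colP => i; rewrite mxE.
  have [j ->|->] := unliftP ord0 i; last exact: g00.
  by have [k ->|->] := unliftP ord0 j; [exact: gS|exact: g1].
case/eqP: xx0; rewrite /x0; apply: (mulIf g1); rewrite divfK //.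
by apply/eqP; rewrite -addr_eq0 addrC gx.
Qed.

End Hat.

Section StdMeasure.
Variables (R : realType) (d : nat).
Let mu := lebesgue_rV R d.

Lemma hyperplanes_negligible (hs : seq 'cV[R]_d.+1) : all (fun g => g != 0) hs ->
  mu.-negligible [set x : borel_rV R d | ~~ all (fun g => aff g x != 0) hs].
Proof.
elim: hs => [_|g hs IH /= /andP[g0 hs0]].
  by rewrite (_ : [set _ | _] = set0); [exact: negligible_set0|apply/seteqP; split].
have gN : mu.-negligible [set x : borel_rV R d | aff g x = 0].
  by apply/negligibleP; [exact: hyperplane_measurable|exact: hyperplane_null].
apply: negligibleS (negligibleU gN (IH hs0)) => x /=.
by rewrite negb_and negbK => /orP[/eqP ?|?]; [left|right].
Qed.

(** A linear relation between indicators that holds off finitely many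
    hyperplanes can be integrated over any Borel set. *)
Lemma std_measure_comb (K : finType) (c : K -> R) (Q : K -> set (borel_rV R d))
    (P : set (borel_rV R d)) (hs : seq 'cV[R]_d.+1) :
  measurable P ->
  (forall k, measurable (Q k)) ->
  (forall k, mu (Q k) < +oo)%E ->
  all (fun g => g != 0) hs ->
  (forall x : borel_rV R d, all (fun g => aff g x != 0) hs ->
     (x \in P)%:R = \sum_k c k * (x \in Q k)%:R :> R) ->
  std_measure P = \sum_k c k *: std_measure (Q k).
Proof.
move=> mP mQ fQ hs0 PQ; apply/funext => -[A mA].
rewrite fct_sumE /std_measure /=.
have fin k : mu (A `&` Q k) \is a fin_num.
  rewrite ge0_fin_numE //; apply: le_lt_trans (fQ k).
  by apply: le_measure; rewrite ?inE //; exact: measurableI.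
suff -> : mu (A `&` P) = (\sum_k c k * fine (mu (A `&` Q k)))%:E by [].
have iQ k : mu.-integrable A (fun x => (\1_(Q k) x)%:E).
  apply: (@integrableS _ _ _ _ setT) => //.
  apply/integrableP; split; first exact/measurable_EFinP/measurable_indic.
  rewrite (eq_integral (fun x => (\1_(Q k) x)%:E)); last first.
    by move=> x _; rewrite gee0_abs // lee_fin.
  by rewrite integral_indic // setIT fQ.
transitivity (\int[mu]_(x in A) (\1_P x)%:E)%E.
  by rewrite integral_indic // setIC.
transitivity (\int[mu]_(x in A) (\sum_k (c k)%:E * (\1_(Q k) x)%:E))%E.
  apply: ae_eq_integral => //.
  - exact/measurable_EFinP/measurable_indic.
  - apply: emeasurable_sum => k.
    by apply: measurable_funeM; exact/measurable_EFinP/measurable_indic.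
  - apply: negligibleS (hyperplanes_negligible hs0) => x /= nx.
    apply: contra_notN nx => /PQ e _.
    rewrite indicE e -sumEFin; apply: eq_bigr => k _; by rewrite EFinM indicE.
rewrite integral_sum // => [|k]; last exact: integrableZl.
rewrite -sumEFin; apply: eq_bigr => k _.
by rewrite integralZl // integral_indic // setIC EFinM fineK.
Qed.

End StdMeasure.

(** * Simplices in barycentric coordinates *)

Section Barycentric.
Variables (R : realType) (d : nat).
Implicit Types (T : d.+1.-tuple 'rV[R]_d) (x y : 'rV[R]_d).

Definition height_form : 'cV[R]_d.+1 := delta_mx 0 0.

Lemma hat_affine x : affine_point height_form (hat x).
Proof.
rewrite /affine_point /height_form -colE; apply/rowP => i.
by rewrite ord1 !mxE -[RHS](hat0 x) mxE.
Qed.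

Lemma affine_pointP (u : 'rV[R]_d.+1) :
  affine_point height_form u -> u = hat (\row_i u 0 (lift ord0 i)).
Proof.
rewrite /affine_point /height_form -colE => /rowP/(_ 0); rewrite !mxE => u0.
apply/rowP => i; have [j ->|->] := unliftP ord0 i; last by rewrite hat0.
by rewrite hatS mxE.
Qed.

Lemma hat_inj : injective (@hat R d).
Proof. by move=> x y exy; apply/rowP => i; rewrite -[LHS]hatS -[RHS]hatS exy. Qed.

Lemma hat_lin t x y : hat (t *: x + (1 - t) *: y) = t *: hat x + (1 - t) *: hat y.
Proof.
apply/rowP => i; rewrite [RHS]mxE [X in _ = X + _]mxE [X in _ = _ + X]mxE.
have [j ->|->] := unliftP ord0 i; first by rewrite !hatS !mxE.
by rewrite !hat0; ring.
Qed.

Definition vmat T : 'M[R]_d.+1 := \matrix_i hat (tnth T i).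

Lemma row_vmat T i : row i (vmat T) = hat (tnth T i).
Proof. exact: rowK. Qed.

Definition bary T j x : R := (hat x *m invmx (vmat T)) 0 j.

Lemma bary_aff T j x : bary T j x = aff (col j (invmx (vmat T))) x.
Proof. by rewrite /bary /aff !mxE; apply: eq_bigr => k _; rewrite !mxE. Qed.

Lemma vmat_affine T : affine_rows height_form (vmat T).
Proof. by apply/affine_rowsP => i; rewrite rowK; exact: hat_affine. Qed.

(** A nonzero linear relation between the columns of the matrix of homogeneous
    coordinates is the equation of a hyperplane through the points; its
    coefficients off the constant term cannot all vanish. *)
Lemma spanning_unit T : spanning [set` T] <-> vmat T \in unitmx.
Proof.
rewrite unitmxE unitfE -det_tr; split=> [spT|uT].
  apply/negP => /eqP/eqP/det0P[g g0 gT]; apply: spT.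
  have vg v : v \in T -> aff g^T v = 0.
    move=> /tnthP[i ->]; have : (vmat T *m g^T) i 0 = 0.
      by rewrite -[vmat T]trmxK -trmx_mul gT !mxE.
    by move=> Tg; rewrite /aff -(row_vmat T i) -row_mul mxE.
  pose a : 'cV[R]_d := \col_i g 0 (lift ord0 i).
  have affa v : aff g^T v = g 0 0 + (v *m a) 0 0.
    by rewrite affE !mxE; congr (_ + _); apply: eq_bigr => i _; rewrite ?mxE.
  exists [set v | v *m a = (- g 0 0)%:M].
    exists a, (- g 0 0); split => //; apply: contra g0 => /eqP a0.
    have := vg (tnth T 0) (mem_tnth _ _); rewrite affa a0 mulmx0 [X in _ + X]mxE addr0 => g00.
    apply/eqP/rowP => i; rewrite [RHS]mxE; have [j ->|->//] := unliftP ord0 i.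
    by move/colP: a0 => /(_ j); rewrite !mxE.
  move=> v /= /vg; rewrite affa => /eqP; rewrite addrC addr_eq0 => /eqP e.
  by apply/matrixP => i j; rewrite !ord1 e mxE eqxx.
case=> H [a [b [a0 ->]]] TH; case/negP: uT; apply/det0P.
pose g : 'rV[R]_d.+1 := \row_i (if unlift ord0 i is Some j then a j 0 else - b).
exists g.
  apply: contra a0 => /eqP g0; apply/eqP/colP => j; rewrite mxE.
  by move/rowP: g0 => /(_ (lift ord0 j)); rewrite !mxE liftK.
apply/trmx_inj; rewrite trmx_mul trmxK trmx0; apply/row_matrixP => i.
rewrite row_mul rowK row0; apply/rowP => j; rewrite ord1 -/(aff _ _) affE !mxE unlift_none.
have /= := TH _ (mem_tnth i T) => /matrixP/(_ 0 0); rewrite !mxE eqxx mulr1n => <-.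
by rewrite addrC; apply/eqP; rewrite subr_eq0; apply/eqP/eq_bigr => k _; rewrite !mxE liftK.
Qed.

Variable T : d.+1.-tuple 'rV[R]_d.
Hypothesis uT : vmat T \in unitmx.

Lemma bary_sum x : \sum_j bary T j x = 1.
Proof.
have -> : 1 = (hat x *m invmx (vmat T) *m (vmat T *m height_form)) 0 0.
  by rewrite mulmxA mulmxKV // hat_affine mxE.
by rewrite vmat_affine mxE; apply: eq_bigr => j _; rewrite [X in _ * X]mxE mulr1.
Qed.

Lemma bary_comb x : x = \sum_j bary T j x *: tnth T j.
Proof.
apply/rowP => i; rewrite -hatS -[hat x](mulmxKV uT) mxE summxE.
by apply: eq_bigr => j _; rewrite [RHS]mxE -(hatS (tnth T j)) -row_vmat [in RHS]mxE.
Qed.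

Lemma bary_lin j t x y :
  bary T j (t *: x + (1 - t) *: y) = t * bary T j x + (1 - t) * bary T j y.
Proof.
by rewrite /bary hat_lin mulmxDl -!scalemxAl [LHS]mxE
  [X in X + _ = _]mxE [X in _ + X = _]mxE.
Qed.

Lemma bary_of_comb (a : 'I_d.+1 -> R) j : \sum_i a i = 1 ->
  bary T j (\sum_i a i *: tnth T i) = a j.
Proof.
move=> a1; rewrite /bary (_ : hat _ = \row_i a i *m vmat T) ?mulmxK ?mxE //.
apply/rowP => k; rewrite [RHS]mxE; under [RHS]eq_bigr do rewrite [X in X * _]mxE [X in _ * X]mxE.
have [l ->|->] := unliftP ord0 k; last first.
  by rewrite hat0 -a1; apply: eq_bigr => i _; rewrite hat0 mulr1.
by rewrite hatS summxE; apply: eq_bigr => i _; rewrite hatS mxE.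
Qed.

Lemma bary_vertex i j : bary T j (tnth T i) = (i == j)%:R.
Proof.
by rewrite /bary -row_vmat -row_mul mulmxV // !mxE.
Qed.

End Barycentric.

Section ConvexSum.
Variables (R : realType) (V : lmodType R).

Lemma convex_setP (A : set V) : convex_set A <->
  forall x y (t : R), 0 <= t <= 1 -> A x -> A y -> A (t *: x + (1 - t) *: y).
Proof.
split=> [cA x y t t01 Ax Ay|cA x y t].
  have /set_mem := cA x y (Itv01 (proj1 (andP t01)) (proj2 (andP t01))) (mem_set Ax) (mem_set Ay).
  by [].
move=> /set_mem Ax /set_mem Ay; apply/mem_set.
have := cA x y t%:num; apply => //.
by apply/andP; split.
Qed.

Lemma convex_sum (A : set V) n (c : 'I_n -> R) (v : 'I_n -> V) :
  convex_set A -> (forall j, 0 <= c j) -> \sum_j c j = 1 -> (forall j, A (v j)) ->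
  A (\sum_j c j *: v j).
Proof.
move=> /convex_setP cA; elim: n c v => [|n IH] c v c0 c1 Av.
  by move/eqP: c1; rewrite big_ord0 eq_sym oner_eq0.
rewrite big_ord_recl in c1; rewrite big_ord_recl.
have S0 : 0 <= \sum_(i < n) c (lift ord0 i) by apply: sumr_ge0.
have [s0|s0] := eqVneq (\sum_(i < n) c (lift ord0 i)) 0.
  rewrite big1 => [|i _]; last first.
    by rewrite (psumr_eq0P _ s0) ?scale0r.
  by move: c1; rewrite s0 !addr0 => ->; rewrite scale1r.
have -> : \sum_(i < n) c (lift ord0 i) *: v (lift ord0 i) =
    (1 - c ord0) *: \sum_(i < n) (c (lift ord0 i) / (1 - c ord0)) *: v (lift ord0 i).
  rewrite scaler_sumr; apply: eq_bigr => i _; rewrite scalerA; congr (_ *: _).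
  by rewrite mulrC divfK // -c1 addrAC subrr add0r.
have S1 : 1 - c ord0 = \sum_(i < n) c (lift ord0 i) by rewrite -c1 addrAC subrr add0r.
apply: cA => //; first by rewrite c0 /= -subr_ge0 S1.
rewrite S1; apply: IH => [j||j]; rewrite ?divr_ge0 //.
by rewrite -mulr_suml mulfV.
Qed.

End ConvexSum.

Section Simplex.
Variables (R : realType) (d : nat) (T : d.+1.-tuple 'rV[R]_d).
Hypothesis uT : vmat T \in unitmx.

Lemma simplex_bary : simplex T = [set x | forall j, 0 <= bary T j x].
Proof.
apply/seteqP; split=> x /=.
  move=> /(_ [set y | forall j, 0 <= bary T j y]); apply; split; last first.
    by move=> v /= /tnthP[i ->] j; rewrite bary_vertex // ler0n.
  apply/convex_setP => u v t /andP[t0 t1] u0 v0 j.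
  by rewrite bary_lin addr_ge0 // mulr_ge0 // subr_ge0.
move=> x0 A [cA TA]; rewrite (bary_comb uT x).
apply: convex_sum => // [|j]; first exact: bary_sum.
by apply: TA; exact: mem_tnth.
Qed.

Lemma bary_continuous j : continuous (bary T j).
Proof.
have -> : bary T j = aff (col j (invmx (vmat T))).
  by apply/funext => y; exact: bary_aff.
exact: aff_continuous.
Qed.

Lemma closed_simplex : closed (simplex T).
Proof.
have -> : simplex T = \bigcap_(j in [set: 'I_d.+1]) (bary T j @^-1` [set t | 0 <= t]).
  by rewrite simplex_bary; apply/seteqP; split=> x /= h; [move=> j _|move=> j]; exact: h.
apply: closed_bigI => j _; apply: preimage_closed; last exact: closed_ge.
by move=> x _; exact: bary_continuous.
Qed.

Lemma bary_pos_open_simplex x : (forall j, 0 < bary T j x) -> open_simplex T x.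
Proof.
move=> x0; pose U : set 'rV[R]_d :=
  ~` \bigcup_(j in [set: 'I_d.+1]) (bary T j @^-1` [set t | t <= 0]).
have oU : open U.
  apply/closed_openC/closed_bigcup => [|j _]; first exact: finite_finset.
  apply: preimage_closed; last exact: closed_le.
  by move=> y _; exact: bary_continuous.
have : U `<=` (simplex T)°.
  rewrite -open_subsetE // simplex_bary => y Uy j.
  by rewrite leNgt; apply/negP => yj; apply: Uy; exists j => //=; exact: ltW.
by apply=> -[j _] /=; rewrite leNgt x0.
Qed.

Lemma in_coneE x : in_cone (vmat T) (hat x) = [forall j, 0 < bary T j x].
Proof. by []. Qed.

(** Moving a point of the simplex slightly towards the barycentre c makes all
    its barycentric coordinates positive. *)
Lemma simplex_sub_closure : simplex T `<=` closure (open_simplex T).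
Proof.
rewrite simplex_bary => x /= x0 B /nbhs_ballP[e /= e0 eB].
pose c : 'rV[R]_d := \sum_j (d.+1%:R^-1) *: tnth T j.
pose D := \sum_i `|x 0 i - c 0 i|.
have D0 : 0 <= D by apply: sumr_ge0.
pose t := e / (e + D + 1).
have t0 : 0 < t by rewrite divr_gt0 //; lra.
have t1 : t <= 1 by rewrite ler_pdivrMr; lra.
have bc j : bary T j c = d.+1%:R^-1.
  rewrite (bary_of_comb uT (a := fun=> d.+1%:R^-1)) //.
  by rewrite sumr_const card_ord -[LHS]mulr_natl divff ?pnatr_eq0.
exists (t *: c + (1 - t) *: x); split.
  apply: bary_pos_open_simplex => j; rewrite bary_lin bc.
  have p0 : 0 < t * d.+1%:R^-1 by rewrite mulr_gt0 ?invr_gt0 ?ltr0Sn.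
  have q0 : 0 <= (1 - t) * bary T j x by rewrite mulr_ge0 ?subr_ge0.
  exact: ltr_wpDr q0 p0.
apply: eB; apply/ball_rV => // i; rewrite !mxE.
have -> : x 0 i - (t * c 0 i + (1 - t) * x 0 i) = t * (x 0 i - c 0 i) by ring.
rewrite normrM gtr0_norm //; apply: (@le_lt_trans _ _ (t * D)).
  by rewrite ler_wpM2l ?(ltW t0) // /D (bigD1 i) //= lerDl sumr_ge0.
by rewrite mulrAC ltr_pdivrMr ?ltr_pM2l //; lra.
Qed.

Lemma closure_open_simplex : closure (open_simplex T) = simplex T.
Proof.
apply/seteqP; split; last exact: simplex_sub_closure.
rewrite [X in _ `<=` X](iffLR (closure_id _) closed_simplex).
by apply: closureS; exact: interior_subset.
Qed.

Lemma simplex_bounded : exists b : R, simplex T `<=`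
  [set x : 'rV[R]_d | forall i, - b <= x 0 i <= b].
Proof.
exists (\sum_j \sum_i `|tnth T j 0 i|) => x; rewrite simplex_bary => /= x0 i.
rewrite -ler_norml (bary_comb uT x) summxE (le_trans (ler_norm_sum _ _ _)) //.
apply: ler_sum => j _; rewrite mxE normrM (bigD1 i) //=.
rewrite ler_wpDr ?sumr_ge0 // ler_piMl // ger0_norm //.
by rewrite -(bary_sum uT x) (bigD1 j) //= lerDl sumr_ge0.
Qed.

Lemma measurable_simplex : measurable (simplex T : set (borel_rV R d)).
Proof.
rewrite -[X in measurable X]setCK; apply: measurableC; apply: sub_sigma_algebra.
by apply: closed_openC; exact: closed_simplex.
Qed.

Lemma simplex_finite_measure : (lebesgue_rV R d (simplex T) < +oo)%E.
Proof.
have [b Tb] := simplex_bounded.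
have b0 : (forall i : 'I_d, - `|b| <= `|b|) by move=> i; rewrite ge0_cp.
apply: (@le_lt_trans _ _ (lebesgue_rV R d [set x | forall i, - `|b| <= x ord0 i <= `|b|])).
  apply: le_measure; rewrite ?inE; first exact: measurable_simplex.
    exact: (@box_measurable R d (fun=> _) (fun=> _)).
  move=> x /Tb /= xb i; have /andP[h1 h2] := xb i.
  by rewrite (le_trans _ h1) ?lerN2 ?ler_norm // (le_trans h2) ?ler_norm.
by rewrite (lebesgue_rV_box (a := fun=> _) (b := fun=> _)) ?ltry.
Qed.

End Simplex.

(** * Linear spans *)

Section Span.
Variables (R : realType) (V : lmodType R) (F : set V).

Lemma linear_span_gen v : F v -> linear_span F v.
Proof.
move=> Fv; exists 1%N, (fun=> 1), (fun=> v); split=> //.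
by rewrite big_ord1 scale1r.
Qed.

Lemma linear_span0 : linear_span F 0.
Proof. by exists 0%N, (fun=> 0), (fun=> 0); split=> [[]//|]; rewrite big_ord0. Qed.

Lemma linear_spanD u v : linear_span F u -> linear_span F v -> linear_span F (u + v).
Proof.
move=> [n [c [f [Ff ->]]]] [m [e [g [Fg ->]]]].
exists (n + m)%N,
  (fun i : 'I_(n + m) => match fintype.split i with inl j => c j | inr j => e j end),
  (fun i : 'I_(n + m) => match fintype.split i with inl j => f j | inr j => g j end); split.
  by move=> i; case: (fintype.split i).
rewrite big_split_ord; congr (_ + _); apply: eq_bigr => i _.
  by rewrite -[lshift _ _]/(unsplit (inl i)) unsplitK.
by rewrite -[rshift _ _]/(unsplit (inr i)) unsplitK.
Qed.

Lemma linear_spanZ a v : linear_span F v -> linear_span F (a *: v).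
Proof.
move=> [n [c [f [Ff ->]]]]; exists n, (fun i => a * c i), f; split=> //.
by rewrite scaler_sumr; apply: eq_bigr => i _; rewrite scalerA.
Qed.

Lemma linear_span_sum (K : Type) (s : seq K) (f : K -> V) :
  (forall k, linear_span F (f k)) -> linear_span F (\sum_(k <- s) f k).
Proof.
move=> Ff; elim/big_ind: _ => //; [exact: linear_span0|exact: linear_spanD].
Qed.

Lemma linear_span_sub (G : set V) : G `<=` linear_span F -> linear_span G `<=` linear_span F.
Proof.
move=> GF _ [n [c [f [Gf ->]]]]; apply: linear_span_sum => i.
exact/linear_spanZ/GF.
Qed.

End Span.

(** * Dissections *)

Section Dissection.
Variables (R : realType) (d : nat).
Implicit Types (T : d.+1.-tuple 'rV[R]_d) (P S : set 'rV[R]_d).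

Lemma in_cone_scale n (M : 'M[R]_n) (a : R) u : 0 < a ->
  in_cone M (a *: u) = in_cone M u.
Proof.
by move=> a0; apply: eq_forallb => j; rewrite -scalemxAl [X in 0 < X]mxE pmulr_rgt0.
Qed.

Lemma in_cone_gt0 (M : 'M[R]_d.+1) u : M \in unitmx -> affine_rows (height_form R d) M ->
  in_cone M u -> 0 < u 0 0.
Proof.
move=> uM Mh /forallP u0.
have -> : u 0 0 = \sum_j (u *m invmx M) 0 j.
  transitivity ((u *m invmx M *m (M *m height_form R d)) 0 0).
    by rewrite mulmxA mulmxKV // -colE mxE.
  by rewrite Mh mxE; apply: eq_bigr => j _; rewrite [X in _ * X]mxE mulr1.
by rewrite (bigD1 ord0) //= ltr_pwDl // sumr_ge0 // => j _; exact: ltW.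
Qed.

Lemma mem_simplex_in_cone T x : vmat T \in unitmx -> (forall j, bary T j x != 0) ->
  (x \in simplex T) = in_cone (vmat T) (hat x).
Proof.
move=> uT x0; rewrite in_coneE; apply/idP/forallP => [|xpos].
  by rewrite inE simplex_bary // => /= xT j; rewrite lt_neqAle eq_sym x0 xT.
by rewrite inE simplex_bary // => j; exact: ltW.
Qed.

(** A point with no vanishing barycentric coordinate lies in a closed simplex
    only if it lies in the open one, and the open ones are disjoint. *)
Lemma dissection_sum P n (T : 'I_n -> d.+1.-tuple 'rV[R]_d) x :
  dissection P T -> (forall i j, bary (T i) j x != 0) ->
  (x \in P)%:R = \sum_i (in_cone (vmat (T i)) (hat x))%:R :> R.
Proof.
move=> [spT tT <-] x0.
have uT i : vmat (T i) \in unitmx by exact/spanning_unit.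
have [i xi|none] := pickP (fun i => in_cone (vmat (T i)) (hat x)).
  have xo : open_simplex (T i) x.
    by apply: bary_pos_open_simplex => //; apply/forallP; rewrite -in_coneE.
  rewrite mem_set; last by apply: subset_closure; exists i.
  rewrite (bigD1 i) //= xi big1 ?addr0 // => j ji.
  case: (boolP (in_cone _ _)) => // xj; case/eqP: ji.
  apply: tT => //; exists x; split=> //.
  by apply: bary_pos_open_simplex => //; apply/forallP; rewrite -in_coneE.
rewrite big1 => [|i _]; last by rewrite none.
rewrite memNset // => xcl.
have clU : closed (\bigcup_i simplex (T i)).
  apply: closed_bigcup => [|i _]; first exact: finite_finset.
  by apply: closed_simplex.
have : (\bigcup_i simplex (T i)) x.
  rewrite (iffLR (closure_id _) clU); apply: closureS xcl => y [i _ Ty].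
  by exists i => //; exact: interior_subset Ty.
by case=> i _ /mem_set; rewrite mem_simplex_in_cone // none.
Qed.

Definition bary_forms T : seq 'cV[R]_d.+1 :=
  [seq col j (invmx (vmat T)) | j <- enum 'I_d.+1].

Lemma bary_forms_neq0 T : vmat T \in unitmx -> all (fun g => g != 0) (bary_forms T).
Proof.
move=> uT; apply/allP => _ /mapP[j _ ->]; apply/eqP => /colP c0.
have : (vmat T *m invmx (vmat T)) j j = 0.
  by rewrite mxE big1 // => k _; have := c0 k; rewrite !mxE => ->; rewrite mulr0.
by rewrite mulmxV // mxE eqxx => /eqP; rewrite oner_eq0.
Qed.

Lemma bary_formsP T x : all (fun g => aff g x != 0) (bary_forms T) ->
  forall j, bary T j x != 0.
Proof.
move=> /allP gx j; rewrite bary_aff; apply: gx.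
by apply/mapP; exists j; rewrite ?mem_enum.
Qed.

(** Both sums are the indicator of P at points of height 1.  The indicators of
    the cones are invariant under positive scaling, and they vanish at points
    of negative height. *)
Lemma dissections_agree P n (T : 'I_n -> d.+1.-tuple 'rV[R]_d)
    m (U : 'I_m -> d.+1.-tuple 'rV[R]_d) :
  dissection P T -> dissection P U ->
  generically (fun u => \sum_i (in_cone (vmat (T i)) u)%:R =
                        \sum_i (in_cone (vmat (U i)) u)%:R :> R).
Proof.
move=> dT dU.
have [[spT _ _] [spU _ _]] := (dT, dU).
have uT i : vmat (T i) \in unitmx by exact/spanning_unit.
have uU i : vmat (U i) \in unitmx by exact/spanning_unit.
have G (k : nat) (V : 'I_k -> d.+1.-tuple 'rV[R]_d) : (forall i, vmat (V i) \in unitmx) ->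
    generically (fun u : 'rV[R]_d.+1 => forall i j, (u *m invmx (vmat (V i))) 0 j != 0).
  move=> uV; apply: generically_forall => i.
  exists (bary_forms (V i)); first exact: bary_forms_neq0.
  move=> u /allP ug j.
  suff -> : (u *m invmx (vmat (V i))) 0 j = (u *m col j (invmx (vmat (V i)))) 0 0.
    by apply: ug; apply/mapP; exists j; rewrite ?mem_enum.
  by rewrite !mxE; apply: eq_bigr => l _; rewrite mxE.
have unit0 : height_form R d != 0.
  by apply/eqP => /colP/(_ 0); rewrite !mxE eqxx => /eqP; rewrite oner_eq0.
apply: generically_mono (generically_and (generically_neq unit0)
  (generically_and (G _ T uT) (G _ U uU))) => u [].
rewrite /height_form -colE mxE => u0 [uTn uUn].
case: (ltgtP 0 (u 0 0)) u0 => // u0 _; last first.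
  have neg (k : nat) (V : 'I_k -> d.+1.-tuple 'rV[R]_d) :
      (forall i, vmat (V i) \in unitmx) -> \sum_i (in_cone (vmat (V i)) u)%:R = 0 :> R.
    move=> uV; apply: big1 => i _; case: (boolP (in_cone _ _)) => //.
    by move=> /(in_cone_gt0 (uV i) (vmat_affine _)); rewrite ltNge ltW.
  by rewrite !neg.
have [x uE] : exists x, u = u 0 0 *: hat x.
  have : affine_point (height_form R d) ((u 0 0)^-1 *: u).
    rewrite /affine_point -scalemxAl /height_form -colE; apply/rowP => i.
    by rewrite ord1 !mxE mulVf // gt_eqF.
  move=> /affine_pointP; set y := \row_i _ => e; exists y.
  by rewrite -e scalerA mulfV ?scale1r // gt_eqF.
have nz (k : nat) (V : 'I_k -> d.+1.-tuple 'rV[R]_d) :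
    (forall i j, (u *m invmx (vmat (V i))) 0 j != 0) -> forall i j, bary (V i) j x != 0.
  move=> Vn i j; have := Vn i j; rewrite uE -scalemxAl mxE mulf_eq0 negb_or.
  by case/andP.
rewrite uE; under eq_bigr do rewrite in_cone_scale //.
under [RHS]eq_bigr do rewrite in_cone_scale //.
by rewrite -(dissection_sum dT (nz _ _ uTn)) -(dissection_sum dU (nz _ _ uUn)).
Qed.

End Dissection.

(** * Measures of polytopes on S *)

Section Main.
Variables (R : realType) (d : nat).
Implicit Types (T : d.+1.-tuple 'rV[R]_d) (P S : set 'rV[R]_d).

Lemma simplex_polytopes_on S T : spanning [set` T] -> [set` T] `<=` S ->
  polytopes_on S (simplex T).
Proof.
move=> spT TS; have uT : vmat T \in unitmx by exact/spanning_unit.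
split.
  exists 1%N, (fun=> simplex T); split; last by rewrite bigcup_const //; exists ord0.
  move=> _; exists [set` T]; first exact: finite_seq.
  split=> // -[H hH TH]; apply: spT; exists H => // v Tv.
  by apply: TH => A [_]; exact.
move=> v /(_ 1%N (fun=> T)) vT; apply: TS; case: vT => [|_ //].
split=> //; first by move=> i j _ _ _; rewrite (ord1 i) (ord1 j).
by rewrite bigcup_const ?closure_open_simplex //; exists ord0.
Qed.

Lemma vmat_of_rows (N : 'M[R]_d.+1) S :
  (forall i, [set u | exists2 v, S v & u = hat v] (row i N)) ->
  exists2 T, N = vmat T & [set` T] `<=` S.
Proof.
move=> NS; have /choice[v vP] : forall i, exists v, S v /\ row i N = hat v.
  by move=> i; have [v Sv e] := NS i; exists v.
exists [tuple v i | i < d.+1].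
  by apply/row_matrixP => i; rewrite row_vmat tnth_mktuple; case: (vP i).
by move=> _ /tnthP[i ->]; rewrite tnth_mktuple; case: (vP i).
Qed.

(** A point outside S is not a vertex of P, which provides a dissection that
    avoids it; this is the input of vertex_elimination. *)
Lemma std_measure_of_dissections S P :
  (exists n (T : 'I_n -> d.+1.-tuple 'rV[R]_d), dissection P T) ->
  polytope_vertex P `<=` S -> simplex_measures S (std_measure P).
Proof.
move=> [n [T dT]] vP; have [spT _ clT] := dT.
have uT i : vmat (T i) \in unitmx by exact/spanning_unit.
pose Shat := [set u | exists2 v, S v & u = hat v].
have [i|u uh nSu|K [c [N [cN [hs hs0 hsP]]]]] :=
  @vertex_elimination _ _ (height_form R d) Shat 'I_n (fun i => vmat (T i)).
- by split; [exact: uT|exact: vmat_affine].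
- have [w uw] : exists w, u = hat w by eexists; exact: affine_pointP uh.
  have nvw : ~ polytope_vertex P w by move=> /vP Sw; apply: nSu; exists w.
  have [m [U [dU wU]]] : exists m (U : 'I_m -> d.+1.-tuple 'rV[R]_d),
      dissection P U /\ forall i, w \notin U i.
    apply: contrapT => nU; apply: nvw => m U dU; apply: contrapT => nw; apply: nU.
    by exists m, U; split=> // i; apply/negP => wi; apply: nw; exists i.
  have [spU _ _] := dU.
  exists 'I_m, (fun i => vmat (U i)); split; last exact: dissections_agree dT dU.
  move=> j; split; [exact/spanning_unit|exact: vmat_affine|move=> k].
  rewrite row_vmat uw (inj_eq (@hat_inj _ _)).
  by apply: contraNneq (wU j) => <-; exact: mem_tnth.
have /choice[U UP] : forall k, exists U : d.+1.-tuple 'rV[R]_d, c k != 0 ->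
    [/\ N k = vmat U, vmat U \in unitmx & [set` U] `<=` S].
  move=> k; have [c0|ck] := eqVneq (c k) 0.
    by exists [tuple 0 | _ < d.+1].
  by have [uN /vmat_of_rows[U NU US]] := cN k ck; exists U; rewrite -NU.
(* The terms with coefficient 0 carry no simplex on S. *)
pose Q k := if c k == 0 then set0 else simplex (U k).
have -> : std_measure P = \sum_k c k *: std_measure (Q k).
  pose Uc k := if c k == 0 then [::] else bary_forms (U k).
  apply: (std_measure_comb
    (hs := hs ++ flatten [seq bary_forms (T i) | i <- enum 'I_n] ++
           flatten [seq Uc k | k <- enum K])) => [|k|k||x].
  - rewrite -clT -[X in measurable X]setCK; apply: measurableC; apply: sub_sigma_algebra.
    by apply: closed_openC; exact: closed_closure.
  - rewrite /Q; case: eqP => [_|/eqP /UP[_ uU _]]; first exact: measurable0.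
    exact: measurable_simplex.
  - rewrite /Q; case: eqP => [_|/eqP /UP[_ uU _]]; first by rewrite measure0 ltry.
    exact: simplex_finite_measure.
  - rewrite !all_cat hs0 /=; apply/andP; split; apply/allP => g /flatten_mapP[i _].
      by move/(allP (bary_forms_neq0 (uT i))).
    rewrite /Uc; case: eqP => // /eqP /UP[_ uU _].
    by move/(allP (bary_forms_neq0 uU)).
  rewrite !all_cat => /and3P[xhs xT xU].
  have xTi i j : bary (T i) j x != 0.
    apply: bary_formsP; apply/allP => g gT; apply: (allP xT).
    by apply/flatten_mapP; exists i; rewrite ?mem_enum.
  rewrite (dissection_sum dT xTi) hsP //; apply: eq_bigr => k _.
  rewrite /Q; case: eqP => [->|/eqP ck]; first by rewrite !mul0r.
  have [-> uU _] := UP k ck; rewrite mem_simplex_in_cone // => j.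
  apply: bary_formsP; apply/allP => g gU; apply: (allP xU).
  by apply/flatten_mapP; exists k; rewrite ?mem_enum // /Uc (negPf ck).
apply: linear_span_sum => k; have [->|ck] := eqVneq (c k) 0.
  rewrite scale0r; exact: linear_span0.
have [_ uU US] := UP k ck; apply/linear_spanZ/linear_span_gen.
exists (U k); first by split=> //; exact/spanning_unit.
by rewrite /Q (negPf ck).
Qed.

Lemma finite_setT_dim0 S : finite_set S -> (forall x, S x) -> d = 0%N.
Proof.
move=> fS ST; case: d S fS ST => // n S fS ST; exfalso; apply: infinite_nat.
have -> : [set: nat] = (fun k => const_mx k%:R : 'rV[R]_n.+1) @^-1` S.
  by apply/seteqP; split=> // k _; exact: ST.
apply: finite_preimage fS => i j _ _ /rowP/(_ 0); rewrite !mxE => /eqP.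
by rewrite eqr_nat => /eqP.
Qed.

End Main.

(** In dimension 0 the space is a single point, which is a simplex. *)
Lemma std_measure_dim0 (R : realType) (S P : set 'rV[R]_0) :
  (forall x, S x) -> simplex_measures S (std_measure P).
Proof.
move=> ST; have [->|/set0P[x Px]] := eqVneq P set0.
  rewrite (_ : std_measure set0 = 0); first exact: linear_span0.
  by apply/funext => A; rewrite /std_measure setI0 measure0.
have allE (y : 'rV[R]_0) : y = x by apply/rowP => -[].
have -> : P = simplex [tuple x].
  apply/seteqP; split=> y _; last by rewrite (allE y).
  by move=> A [_]; apply; rewrite /= inE (allE y).
apply: linear_span_gen; exists [tuple x] => //; split=> // -[H [a [b [a0 _]]] _].
by case/eqP: a0; apply/colP => -[].
Qed.

Theorem theorem9 (R : realType) (d : nat) (S : set 'rV[R]_d) :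
  finite_set S -> spanning S -> weakly_nondegenerate S ->
  (forall P, polytopes_on S P -> simplex_measures S (std_measure P)) /\
  polytope_measures S = simplex_measures S.
Proof.
move=> fS _ _.
have H P : polytopes_on S P -> simplex_measures S (std_measure P).
  (* If P had no dissection, every point would be a vertex of P; so a point
     outside S provides one.  There is no such point only in dimension 0. *)
  move=> [gP vP]; have [[v nSv]|ST] := pselect (exists v, ~ S v).
    apply: (std_measure_of_dissections _ vP).
    apply: contrapT => noD; apply/nSv/vP => n T dT; exfalso; apply: noD.
    by exists n, T.
  have {}ST x : S x by apply: contrapT => nSx; apply: ST; exists x.
  have d0 := finite_setT_dim0 fS ST; move: S P fS gP vP ST; rewrite d0 => S P _ _ _ ST.
  exact: std_measure_dim0.
split=> //; apply/seteqP; split; apply: linear_span_sub => m.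
  by move=> [P PS <-]; exact: H.
move=> [T [spT TS] <-]; apply: linear_span_gen; exists (simplex T) => //.
exact: simplex_polytopes_on.
Qed.
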